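(* Fix a countable set $I$ and $R\in[0,\infty)^I$. Given $\ell\in\Sigma_R$, let $\vartheta_\ell=(\pi_\ell(T_i))_{i\in I}$. Then given any $\|\cdot\|_R$-bounded, weak$^*$-to-$\|\cdot\|_{R,2}$ continuous function $\Sigma_R\to\mathcal F_R$, denoted $\ell\mapsto f_\ell$, there is an $\ell\in\Sigma_R$ so that $W^*(f_\ell(\vartheta_\ell))\neq W^*(\ell)$.
   Context: $\mathbb{C}^*\langle(T_i)_{i\in I}\rangle$ denotes the noncommutative $*$-polynomials in variables indexed by $I$ (the free unital $*$-algebra on $I$). A tracial von Neumann algebra $(M,\tau)$ is a von Neumann algebra with a faithful normal tracial state; $\|x\|_2=\tau(x^*x)^{1/2}$, and $\mathrm{Ball}(M)$ is the operator norm unit ball. $\Sigma_R$ is the set of linear functionals $\ell$ on $\mathbb{C}^*\langle(T_i)_{i\in I}\rangle$ with $\ell(1)=1$, $\ell(PQ)=\ell(QP)$, $\ell(P^*P)\ge0$ and $\ell((T_i^*T_i)^k)\le R_i^{2k}$ for all $*$-polynomials $P,Q$, all $i\in I$ and all $k\in\mathbb{N}$, with the weak$^*$-topology (pointwise convergence on $*$-polynomials); it is compact. For a tracial von Neumann algebra $(M,\tau)$ and $x\in\prod_{i\in I}R_i\mathrm{Ball}(M)$, $\ell_x(P)=\tau(P(x))$ defines $\ell_x\in\Sigma_R$. For $\ell\in\Sigma_R$: $L^2(\ell)$ is the separation/completion of $\mathbb{C}^*\langle(T_i)_{i\in I}\rangle$ under $\langle P,Q\rangle_\ell=\ell(P^*Q)$;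 $[P]$ is the image of $P$ in $L^2(\ell)$; $\pi_\ell$ is the unique $*$-homomorphism from $\mathbb{C}^*\langle(T_i)_{i\in I}\rangle$ to $B(L^2(\ell))$ with $\pi_\ell(P)[Q]=[PQ]$ (it satisfies $\|\pi_\ell(T_i)\|\le R_i$); $W^*(\ell)$ is the SOT-closure of the image of $\pi_\ell$, a tracial von Neumann algebra with trace $\tau_\ell(x)=\langle x[1],[1]\rangle$. One has $\ell_{\vartheta_\ell}=\ell$. Definition of $\mathcal F_R$: let $\mathcal A_R=C(\Sigma_R)\otimes_{\mathrm{alg}}\mathbb{C}^*\langle(T_i)_{i\in I}\rangle$. For $(M,\tau)$ a tracial von Neumann algebra and $x\in\prod_{i\in I}R_i\mathrm{Ball}(M)$, evaluate $(\phi\otimes P)(x)=\phi(\ell_x)P(x)$, extended linearly. Set $\|f\|_{R,2}=\sup\|f(x)\|_2$ over all such $(M,\tau)$ and $x$, and let $\mathcal F_{R,2}$ be the separation/completion of $\mathcal A_R$ under $\|\cdot\|_{R,2}$; evaluation extends to $f(x)\in L^2(M,\tau)$ for $f\in\mathcal F_{R,2}$. Set $\|f\|_R=\sup\|f(x)\|_\infty\in[0,\infty]$ over all such $(M,\tau)$ and $x$ (operator norm, $+\infty$ if $f(x)\notin M$), and $\mathcal F_R=\{f\in\mathcal F_{R,2}:\|f\|_R<\infty\}$, so that $f(x)\in M$ for $f\in\mathcal F_R$. That $\ell\mapsto f_\ell$ is $\|\cdot\|_R$-bounded means $\sup_{\ell}\|f_\ell\|_R<\infty$. For an element $y$ of a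 von Neumann algebra, $W^*(y)$ is the von Neumann subalgebra generated by $y$.
   Formalization: The formal theorem assumes that R_i > 0 for at least two distinct indices i in I; otherwise the claim is false, since the constant function f_ℓ = T_i (or any f, when all R_i = 0) generates W*(ℓ) for every ℓ. *)

(* Defs.v *)
From HB Require Import structures.
From mathcomp Require Import all_boot all_order all_algebra finmap sesquilinear.
From mathcomp Require Import all_classical all_reals all_analysis.
From mathcomp Require Import complex ring lra.
(* The notations of [monalg] clash with those of mathcomp-analysis. *)
From mathcomp Require Import -(notations) monalg.

Set Implicit Arguments.
Unset Strict Implicit.
Unset Printing Implicit Defensive.

Import Order.TTheory GRing.Theory Num.Theory numFieldNormedType.Exports.

Local Open Scope classical_set_scope.
Local Open Scope ring_scope.

(* Separation/completion of the subset D of V under the (possibly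
   infinite-valued) seminorm N, as the set of equivalence classes of N-Cauchy
   sequences of elements of D. *)
Section Completion.
Context {R : realType} {V : zmodType}.
Variables (D : set V) (N : V -> \bar R).

Definition cauchy_in (u : nat -> V) : Prop :=
  (forall n, D (u n)) /\
  forall e : R, 0 < e -> exists n0, forall n m, (n0 <= n)%N -> (n0 <= m)%N ->
    (N (u n - u m)%R < e%:E)%E.

Definition cauchy_class (u : nat -> V) : set (nat -> V) :=
  [set v | cauchy_in v /\
    forall e : R, 0 < e -> exists n0, forall n, (n0 <= n)%N ->
      (N (u n - v n)%R < e%:E)%E].

Definition completion : set (set (nat -> V)) := cauchy_class @` cauchy_in.

Definition embed (v : V) : set (nat -> V) := cauchy_class (fun=> v).

Definition reprc (c : set (nat -> V)) : nat -> V := xget (fun=> 0) c.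

(* The N-distance of two classes; it does not depend on the representatives. *)
Definition cdist (c d : set (nat -> V)) : \bar R :=
  limn (fun n => N (reprc c n - reprc d n)).

End Completion.

Section SemiInner.
Context {R : realType}.
Local Notation C := R[i].

Record semi_inner (V : lmodType C) := SemiInner {
  sip :> V -> V -> C;
  sipDZl : forall a u v w, sip (a *: u + v) w = a * sip u w + sip v w;
  sipC : forall u v, sip u v = (sip v u)^*;
  sip_ge0 : forall u, 0 <= sip u u }.

Definition sinorm (V : lmodType C) (p : semi_inner V) (v : V) : R :=
  Num.sqrt (complex.Re (p v v)).

(* The Hilbert space completion of a space with a semi-inner product. *)
Definition hcompletion (V : lmodType C) (p : semi_inner V) : Type :=
  completion [set: V] (fun v => (sinorm p v)%:E).

Section Theory.
Variables (V : lmodType C) (p : semi_inner V).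
Local Notation N := (sinorm p).

Lemma sipDl u v w : p (u + v) w = p u w + p v w.
Proof. by rewrite -[u]scale1r sipDZl mul1r scale1r. Qed.
Lemma sip0l w : p 0 w = 0.
Proof. by apply: (addrI (p 0 w)); rewrite -sipDl !addr0. Qed.
Lemma sipZl a u w : p (a *: u) w = a * p u w.
Proof. by rewrite -[a *: u]addr0 sipDZl sip0l addr0. Qed.
Lemma sipNl u w : p (- u) w = - p u w.
Proof. by rewrite -scaleN1r sipZl mulN1r. Qed.
Lemma sipBl u v w : p (u - v) w = p u w - p v w.
Proof. by rewrite sipDl sipNl. Qed.
Lemma sipDr u v w : p w (u + v) = p w u + p w v.
Proof. by rewrite sipC sipDl rmorphD /= -!sipC. Qed.
Lemma sipZr a u w : p w (a *: u) = a^* * p w u.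
Proof. by rewrite sipC sipZl rmorphM /= -!sipC. Qed.
Lemma sipNr u w : p w (- u) = - p w u.
Proof. by rewrite sipC sipNl rmorphN /= -!sipC. Qed.
Lemma sipBr u v w : p w (u - v) = p w u - p w v.
Proof. by rewrite sipDr sipNr. Qed.

Lemma sipE v : p v v = ((N v) ^+ 2)%:C%C.
Proof.
have := sip_ge0 p v; rewrite lecE /= => /andP[/eqP h0 h1].
by rewrite /sinorm sqr_sqrtr //; case: (p v v) h0 => x y /= ->.
Qed.
Lemma sinorm_ge0 v : 0 <= N v. Proof. exact: sqrtr_ge0. Qed.
Lemma sinorm_sqr v : N v ^+ 2 = complex.Re (p v v).
Proof. by rewrite sipE. Qed.

Lemma Re_conj (z : C) : complex.Re z^* = complex.Re z.
Proof. by case: z. Qed.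
Lemma Im_conj (z : C) : complex.Im z^* = - complex.Im z.
Proof. by case: z. Qed.

Lemma ReD (z w : C) : complex.Re (z + w) = complex.Re z + complex.Re w.
Proof. by case: z w => ? ? []. Qed.
Lemma ReN (z : C) : complex.Re (- z) = - complex.Re z.
Proof. by case: z. Qed.
Lemma ImD (z w : C) : complex.Im (z + w) = complex.Im z + complex.Im w.
Proof. by case: z w => ? ? []. Qed.
Lemma ImN (z : C) : complex.Im (- z) = - complex.Im z.
Proof. by case: z. Qed.
Lemma ReM (z w : C) : complex.Re (z * w) =
  complex.Re z * complex.Re w - complex.Im z * complex.Im w.
Proof. by case: z w => ? ? []. Qed.
Lemma ImM (z w : C) : complex.Im (z * w) =
  complex.Re z * complex.Im w + complex.Im z * complex.Re w.
Proof. by case: z w => ? ? [] ? ? /=. Qed.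

Lemma Re_sipC u v : complex.Re (p u v) = complex.Re (p v u).
Proof. by rewrite sipC Re_conj. Qed.

Lemma sinorm_sqrD u v :
  N (u + v) ^+ 2 = N u ^+ 2 + 2 * complex.Re (p u v) + N v ^+ 2.
Proof.
rewrite !sinorm_sqr sipDl !sipDr !ReD (Re_sipC v u); ring.
Qed.

Lemma sinormZ a v : N (a *: v) = Num.sqrt (complex.Re (a * a^*)) * N v.
Proof.
have h : 0 <= complex.Re (a * a^*) by case: a => x y /=; nra.
rewrite {1}/sinorm sipZl sipZr mulrA [p v v]sipE.
rewrite ReM /= mulr0 subr0 sqrtrM // sqrtr_sqr ger0_norm ?sinorm_ge0 //.
Qed.

Lemma sinormZr (t : R) v : N (t%:C%C *: v) = `|t| * N v.
Proof. by rewrite sinormZ /= mul0r subr0 -expr2 sqrtr_sqr. Qed.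

Lemma sinormN v : N (- v) = N v.
Proof. by rewrite /sinorm sipNl sipNr opprK. Qed.

Lemma sinorm0 : N 0 = 0.
Proof. by rewrite /sinorm sip0l /= sqrtr0. Qed.

Lemma sip_CSr u v : `|complex.Re (p u v)| <= N u * N v.
Proof.
set b := complex.Re _.
have H t : 0 <= N u ^+ 2 + 2 * t * b + t ^+ 2 * N v ^+ 2.
  have := sqr_ge0 (N (u + t%:C%C *: v)).
  rewrite sinorm_sqrD sinormZr sipZr exprMn real_normK ?num_real //.
  rewrite ReM Re_conj Im_conj /= oppr0 mul0r subr0 -/b; lra.
have hu := sinorm_ge0 u; have hv := sinorm_ge0 v.
rewrite -ler_sqr ?nnegrE ?mulr_ge0 // real_normK ?num_real // exprMn.
have [v0|v0] := eqVneq (N v) 0.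
  rewrite v0 expr0n /= mulr0.
  have [->|b0] := eqVneq b 0; first by rewrite expr0n.
  have := H (- (N u ^+ 2 + 1) / (2 * b)).
  rewrite v0 expr0n /= mulr0 addr0.
  have -> : 2 * (- (N u ^+ 2 + 1) / (2 * b)) * b = - (N u ^+ 2 + 1).
    by field; rewrite b0.
  lra.
have v2 : 0 < N v ^+ 2 by rewrite exprn_gt0 // lt_def v0.
have := H (- b / N v ^+ 2).
have -> : N u ^+ 2 + 2 * (- b / N v ^+ 2) * b + (- b / N v ^+ 2) ^+ 2 * N v ^+ 2 =
   (N u ^+ 2 * N v ^+ 2 - b ^+ 2) / N v ^+ 2 by field; rewrite v0.
by rewrite pmulr_lge0 ?invr_gt0 // subr_ge0.
Qed.

Lemma sip_CSi u v : `|complex.Im (p u v)| <= N u * N v.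
Proof.
have h1 : complex.Re (p u ('i%C *: v)) = complex.Im (p u v).
  by rewrite sipZr; case: (p u v) => x y /=; ring.
have h2 : N ('i%C *: v) = N v.
  rewrite sinormZ /= (_ : 0 * 0 - 1 * - 1 = 1) ?sqrtr1 ?mul1r //; ring.
by rewrite -h1 -[in X in _ <= X]h2 sip_CSr.
Qed.

Lemma sinormD u v : N (u + v) <= N u + N v.
Proof.
have hu := sinorm_ge0 u; have hv := sinorm_ge0 v.
rewrite -ler_sqr ?nnegrE ?addr_ge0 ?sinorm_ge0 // sinorm_sqrD.
have := sip_CSr u v; have := ler_norm (complex.Re (p u v)); nra.
Qed.

Lemma sinormB u v : N (u - v) = N (v - u).
Proof. by rewrite -sinormN opprB. Qed.

Lemma sinorm_tri w u v : N (u - v) <= N (u - w) + N (w - v).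
Proof. by have := sinormD (u - w) (w - v); rewrite addrA subrK. Qed.

End Theory.
End SemiInner.

Section HCompletion.
Context {R : realType}.
Local Notation C := R[i].
Variables (V : lmodType C) (p : semi_inner V).
Local Notation N := (sinorm p).
Local Notation NE := (fun v => (sinorm p v)%:E).
Local Notation H := (hcompletion p).

HB.instance Definition _ := Choice.on H.

Definition scauchy (u : nat -> V) := forall e : R, 0 < e ->
  exists n0, forall n m, (n0 <= n)%N -> (n0 <= m)%N -> N (u n - u m) < e.
Definition snull (u : nat -> V) := forall e : R, 0 < e ->
  exists n0, forall n, (n0 <= n)%N -> N (u n) < e.

Lemma scauchyP u : cauchy_in [set: V] NE u <-> scauchy u.
Proof.
split=> [[_ h] e /h[n0 hn]|h].
  by exists n0 => n m hn1 hm; have := hn _ _ hn1 hm; rewrite lte_fin.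
by split.
Qed.

Lemma snullP u v : snull (fun n => u n - v n) <->
  (forall e : R, 0 < e -> exists n0, forall n, (n0 <= n)%N ->
      (NE (u n - v n)%R < e%:E)%E).
Proof. by split=> h e /h[n0 hn]; exists n0 => n /hn; rewrite lte_fin. Qed.

Lemma snull_cst0 : snull (fun=> 0).
Proof. by move=> e e0; exists 0%N => n _; rewrite sinorm0. Qed.

Lemma snullD u v : snull u -> snull v -> snull (fun n => u n + v n).
Proof.
move=> hu hv e e0; have e2 : 0 < e / 2 by rewrite divr_gt0.
have [n hn] := hu _ e2; have [m hm] := hv _ e2.
exists (maxn n m) => k; rewrite geq_max => /andP[/hn h1 /hm h2].
by apply: le_lt_trans (sinormD _ _ _) _; lra.
Qed.

Lemma snullZ a u : snull u -> snull (fun n => a *: u n).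
Proof.
move=> hu e e0; set b := Num.sqrt (complex.Re (a * a^*)).
have b0 : 0 <= b by exact: sqrtr_ge0.
have e2 : 0 < e / (b + 1) by rewrite divr_gt0 //; lra.
have [n hn] := hu _ e2; exists n => k /hn; rewrite sinormZ -/b => h.
have : (b + 1) * N (u k) < e by rewrite mulrC -ltr_pdivlMr //; lra.
have := sinorm_ge0 p (u k); lra.
Qed.

Lemma snullN u : snull u -> snull (fun n => - u n).
Proof. by move=> hu e /hu[n h]; exists n => k /h; rewrite sinormN. Qed.

Lemma snull_ext u v : u =1 v -> snull u -> snull v.
Proof. by move=> /funext ->. Qed.

Lemma scauchyD u v : scauchy u -> scauchy v -> scauchy (fun n => u n + v n).
Proof.
move=> hu hv e e0; have e2 : 0 < e / 2 by rewrite divr_gt0.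
have [n hn] := hu _ e2; have [m hm] := hv _ e2.
exists (maxn n m) => k l; rewrite !geq_max => /andP[h1 h2] /andP[h3 h4].
rewrite opprD addrACA; apply: le_lt_trans (sinormD _ _ _) _.
by have := hn _ _ h1 h3; have := hm _ _ h2 h4; lra.
Qed.

Lemma scauchyZ a u : scauchy u -> scauchy (fun n => a *: u n).
Proof.
move=> hu e e0; set b := Num.sqrt (complex.Re (a * a^*)).
have b0 : 0 <= b by exact: sqrtr_ge0.
have e2 : 0 < e / (b + 1) by rewrite divr_gt0 //; lra.
have [n hn] := hu _ e2; exists n => k l hk hl.
have := hn _ _ hk hl; rewrite -scalerBr sinormZ -/b => h.
have : (b + 1) * N (u k - u l) < e by rewrite mulrC -ltr_pdivlMr //; lra.
have := sinorm_ge0 p (u k - u l); lra.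
Qed.

Lemma scauchyN u : scauchy u -> scauchy (fun n => - u n).
Proof.
by move=> hu e /hu[n h]; exists n => k l hk hl; rewrite -opprD sinormN h.
Qed.

Lemma scauchy_cst v : scauchy (fun=> v).
Proof. by move=> e e0; exists 0%N => n m _ _; rewrite subrr sinorm0. Qed.

Lemma hclass_subproof u : scauchy u ->
  cauchy_class [set: V] NE u \in completion [set: V] NE.
Proof. by move=> /scauchyP hu; apply/mem_set; exists u. Qed.

Definition hclass u (hu : scauchy u) : H :=
  exist _ (cauchy_class [set: V] NE u) (hclass_subproof hu).

Lemma hclass_eq u v (hu : scauchy u) (hv : scauchy v) :
  hclass hu = hclass hv <-> snull (fun n => u n - v n).
Proof.
split=> [/(congr1 val) /= /seteqP[_ /(_ v)]|huv].
  have hvv : cauchy_class [set: V] NE v v.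
    split; first exact/scauchyP.
    by apply/snullP; apply: snull_ext snull_cst0 => n; rewrite subrr.
  by move=> /(_ hvv) [_ /snullP].
apply/val_inj/seteqP; split=> w [hw /snullP h]; split=> //; apply/snullP.
  have := snullD (snullN huv) h; apply: snull_ext => n.
  by rewrite opprB addrA subrK.
by have := snullD huv h; apply: snull_ext => n; rewrite addrA subrK.
Qed.

Lemma hclass_exP (c : H) : exists u (hu : scauchy u), c = hclass hu.
Proof.
case: (set_mem (valP c)) => u hu hc; have hu' := (iffLR (scauchyP u) hu).
by exists u, hu'; apply: val_inj.
Qed.

Definition hrep (c : H) : nat -> V := reprc (val c).

Lemma hrep_hclass u (hu : scauchy u) :
  scauchy (hrep (hclass hu)) /\ snull (fun n => u n - hrep (hclass hu) n).
Proof.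
suff : cauchy_class [set: V] NE u (hrep (hclass hu)).
  by case=> /scauchyP h /snullP.
apply: xgetPex; exists u; split; first exact/scauchyP.
by apply/snullP; apply: snull_ext snull_cst0 => n; rewrite subrr.
Qed.

Lemma hrepP c : scauchy (hrep c).
Proof. by have [u [hu ->]] := hclass_exP c; case: (hrep_hclass hu). Qed.

Lemma hrepK c : hclass (hrepP c) = c.
Proof.
have [u [hu e]] := hclass_exP c; rewrite [RHS]e; apply/hclass_eq.
move: (hrepP c); rewrite e => h; case: (hrep_hclass hu) => _ /snullN.
by apply: snull_ext => n; rewrite opprB.
Qed.

Definition hadd (c d : H) : H := hclass (scauchyD (hrepP c) (hrepP d)).
Definition hopp (c : H) : H := hclass (scauchyN (hrepP c)).
Definition hscale a (c : H) : H := hclass (scauchyZ a (hrepP c)).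
Definition hzero : H := hclass (scauchy_cst 0).

Lemma hrepE u (hu : scauchy u) : snull (fun n => hrep (hclass hu) n - u n).
Proof.
by case: (hrep_hclass hu) => _ /snullN; apply: snull_ext => n; rewrite opprB.
Qed.

Lemma haddE u v (hu : scauchy u) (hv : scauchy v) :
  hadd (hclass hu) (hclass hv) = hclass (scauchyD hu hv).
Proof.
apply/hclass_eq; have := snullD (hrepE hu) (hrepE hv).
by apply: snull_ext => n; rewrite addrACA -opprD.
Qed.
Lemma hoppE u (hu : scauchy u) : hopp (hclass hu) = hclass (scauchyN hu).
Proof.
apply/hclass_eq; have := snullN (hrepE hu).
by apply: snull_ext => n; rewrite opprD.
Qed.
Lemma hscaleE a u (hu : scauchy u) :
  hscale a (hclass hu) = hclass (scauchyZ a hu).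
Proof.
apply/hclass_eq; have := snullZ a (hrepE hu).
by apply: snull_ext => n; rewrite scalerBr.
Qed.
Lemma hclass_ext u v (hu : scauchy u) (hv : scauchy v) : u =1 v ->
  hclass hu = hclass hv.
Proof.
by move=> e; apply/hclass_eq; apply: snull_ext snull_cst0 => n; rewrite e subrr.
Qed.

Lemma haddA : associative hadd.
Proof.
move=> c d e; rewrite -(hrepK c) -(hrepK d) -(hrepK e) !haddE.
by apply: hclass_ext => n; rewrite addrA.
Qed.
Lemma haddC : commutative hadd.
Proof.
move=> c d; rewrite -(hrepK c) -(hrepK d) !haddE.
by apply: hclass_ext => n; rewrite addrC.
Qed.
Lemma hadd0 : left_id hzero hadd.
Proof.
move=> c; rewrite -(hrepK c) !haddE.
by apply: hclass_ext => n; rewrite add0r.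
Qed.
Lemma haddN : left_inverse hzero hopp hadd.
Proof.
move=> c; rewrite -(hrepK c) hoppE !haddE.
by apply: hclass_ext => n; rewrite addNr.
Qed.

HB.instance Definition _ := GRing.isZmodule.Build H haddA haddC hadd0 haddN.

Lemma hscaleA a b c : hscale a (hscale b c) = hscale (a * b) c.
Proof.
rewrite -(hrepK c) !hscaleE.
by apply: hclass_ext => n; rewrite scalerA.
Qed.
Lemma hscale1 : left_id 1 hscale.
Proof.
move=> c; rewrite -(hrepK c) !hscaleE.
by apply: hclass_ext => n; rewrite scale1r.
Qed.
Lemma hscaleDr : right_distributive hscale +%R.
Proof.
have addE c d : c + d = hadd c d by [].
move=> a c d; rewrite -(hrepK c) -(hrepK d) !addE haddE !hscaleE haddE.
by apply: hclass_ext => n; rewrite scalerDr.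
Qed.
Lemma hscaleDl c : {morph hscale^~ c : a b / a + b}.
Proof.
have addE d e : d + e = hadd d e by [].
move=> a b; rewrite -(hrepK c) !addE !hscaleE haddE.
by apply: hclass_ext => n; rewrite scalerDl.
Qed.

HB.instance Definition _ := GRing.Zmodule_isLmodule.Build C H
  hscaleA hscale1 hscaleDr hscaleDl.

Lemma scauchy_cvg u : scauchy u -> exists2 b : R, 0 <= b & forall n, N (u n) <= b.
Proof.
move=> /(_ 1 ltr01) [n0 hn].
exists (N (u n0) + 1 + \sum_(i < n0) N (u i)).
  by rewrite !addr_ge0 ?sinorm_ge0 ?ler01 ?sumr_ge0 // => i _; exact: sinorm_ge0.
move=> n; have [nn0|nn0] := leqP n0 n.
  have := hn n n0 nn0 (leqnn _); have := sinormD p (u n - u n0) (u n0).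
  rewrite subrK; have : 0 <= \sum_(i < n0) N (u i).
    by apply: sumr_ge0 => i _; exact: sinorm_ge0.
  lra.
rewrite (bigD1 (Ordinal nn0)) //=.
have : 0 <= \sum_(i < n0 | i != Ordinal nn0) N (u i).
  by apply: sumr_ge0 => i _; exact: sinorm_ge0.
by have := sinorm_ge0 p (u n0); lra.
Qed.

Section Limits.
Variable F : C -> R.
Hypothesis FB : forall x y, F (x - y) = F x - F y.
Hypothesis FN : forall x y, `|F (p x y)| <= N x * N y.

Let FD x y : F (x + y) = F x + F y.
Proof.
have F0 : F 0 = 0.
  by have := FB 0 0; rewrite !subrr => ->.
have FO z : F (- z) = - F z by have := FB 0 z; rewrite F0 !sub0r.
by have := FB x (- y); rewrite FO !opprK.
Qed.

Lemma sip_diff u v u' v' :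
  `|F (p u v) - F (p u' v')| <= N (u - u') * N v + N u' * N (v - v').
Proof.
have -> : F (p u v) - F (p u' v') = F (p (u - u') v) + F (p u' (v - v')).
  by rewrite -FB -FD sipBl sipBr addrA subrK.
by apply: le_trans (ler_normD _ _) _; rewrite lerD.
Qed.

Lemma sip_cvg u v : scauchy u -> scauchy v ->
  cvgn (fun n => F (p (u n) (v n))).
Proof.
move=> hu hv; have [a a0 ha] := scauchy_cvg hu; have [b b0 hb] := scauchy_cvg hv.
apply: R_complete; apply: (@cauchy_exP R R) => e e0.
have c0 : 0 < a + b + 1 by lra.
have e2 : 0 < e / (a + b + 1) by rewrite divr_gt0.
have [n hn] := hu _ e2; have [m hm] := hv _ e2.
exists (F (p (u (maxn n m)) (v (maxn n m)))); exists (maxn n m) => // k /= hk.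
apply: le_lt_trans (sip_diff _ _ _ _) _.
have := hk; rewrite geq_max => /andP[h1 h2].
have := hn (maxn n m) k (leq_maxl _ _) h1.
have := hm (maxn n m) k (leq_maxr _ _) h2.
set x := N _; set y := N _ => hx hy.
have x0 : 0 <= x by exact: sinorm_ge0.
have y0 : 0 <= y by exact: sinorm_ge0.
have h3 := ha k; have h4 := hb (maxn n m).
have h5 := sinorm_ge0 p (u k); have h6 := sinorm_ge0 p (v (maxn n m)).
apply: (@le_lt_trans _ _ (e / (a + b + 1) * (a + b))).
  rewrite mulrDr [leRHS]addrC lerD //.
    by apply: ler_pM => //; exact: ltW.
  by rewrite mulrC; apply: ler_pM => //; exact: ltW.
rewrite -mulrA gtr_pMr // mulrC ltr_pdivrMr //; lra.
Qed.

Lemma sip_equiv u v u' v' (l : R) : scauchy u -> scauchy v ->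
  scauchy u' -> scauchy v' ->
  snull (fun n => u n - u' n) -> snull (fun n => v n - v' n) ->
  F (p (u n) (v n)) @[n --> \oo] --> l ->
  F (p (u' n) (v' n)) @[n --> \oo] --> l.
Proof.
move=> hu hv hu' hv' hnu hnv hl.
have [a a0 ha] := scauchy_cvg hu'; have [b b0 hb] := scauchy_cvg hv.
suff h0 : (fun n => F (p (u n) (v n)) - F (p (u' n) (v' n))) @ \oo --> (0 : R).
  rewrite (_ : (fun n => F (p (u' n) (v' n))) = (fun n => F (p (u n) (v n))) -
    (fun n => F (p (u n) (v n)) - F (p (u' n) (v' n)))).
    by rewrite -[l]subr0; exact: cvgB.
  by apply/funext => n; rewrite !fctE opprB addrC subrK.
apply/cvgrPdist_lt => e e0.
have c0 : 0 < a + b + 1 by lra.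
have e2 : 0 < e / (a + b + 1) by rewrite divr_gt0.
have [n hn] := hnu _ e2; have [m hm] := hnv _ e2.
exists (maxn n m) => // k /=; rewrite geq_max => /andP[/hn h1 /hm h2].
rewrite sub0r normrN; apply: le_lt_trans (sip_diff _ _ _ _) _.
have h3 := ha k; have h4 := hb k.
have h5 := sinorm_ge0 p (u' k); have h6 := sinorm_ge0 p (v k).
have h7 := sinorm_ge0 p (u k - u' k); have h8 := sinorm_ge0 p (v k - v' k).
apply: (@le_lt_trans _ _ (e / (a + b + 1) * (a + b))).
  rewrite mulrDr [leRHS]addrC lerD //.
    by apply: ler_pM => //; exact: ltW.
  by rewrite mulrC; apply: ler_pM => //; exact: ltW.
rewrite -mulrA gtr_pMr // mulrC ltr_pdivrMr //; lra.
Qed.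

End Limits.

Definition hdot (c d : H) : C :=
  Complex (limn (fun n => complex.Re (p (hrep c n) (hrep d n))))
          (limn (fun n => complex.Im (p (hrep c n) (hrep d n)))).

Let ReB (x y : C) : complex.Re (x - y) = complex.Re x - complex.Re y.
Proof. by rewrite ReD ReN. Qed.
Let ImB (x y : C) : complex.Im (x - y) = complex.Im x - complex.Im y.
Proof. by rewrite ImD ImN. Qed.

Lemma hdot_cvg_Re u v (hu : scauchy u) (hv : scauchy v) :
  complex.Re (p (u n) (v n)) @[n --> \oo] -->
    complex.Re (hdot (hclass hu) (hclass hv)).
Proof.
have h := sip_cvg ReB (@sip_CSr _ _ p) (hrepP (hclass hu)) (hrepP (hclass hv)).
exact: (sip_equiv ReB (@sip_CSr _ _ p) (hrepP _) (hrepP _) hu hv (hrepE hu)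
  (hrepE hv) h).
Qed.
Lemma hdot_cvg_Im u v (hu : scauchy u) (hv : scauchy v) :
  complex.Im (p (u n) (v n)) @[n --> \oo] -->
    complex.Im (hdot (hclass hu) (hclass hv)).
Proof.
have h := sip_cvg ImB (@sip_CSi _ _ p) (hrepP (hclass hu)) (hrepP (hclass hv)).
exact: (sip_equiv ImB (@sip_CSi _ _ p) (hrepP _) (hrepP _) hu hv (hrepE hu)
  (hrepE hv) h).
Qed.

Lemma hdot_unique u v (hu : scauchy u) (hv : scauchy v) z :
  complex.Re (p (u n) (v n)) @[n --> \oo] --> complex.Re z ->
  complex.Im (p (u n) (v n)) @[n --> \oo] --> complex.Im z ->
  hdot (hclass hu) (hclass hv) = z.
Proof.
move=> h1 h2; apply/eqP; rewrite eq_complex; apply/andP; split; apply/eqP.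
  by apply: cvg_unique h1 => //; exact: hdot_cvg_Re.
by apply: cvg_unique h2 => //; exact: hdot_cvg_Im.
Qed.

Lemma hdotDZl a (c d e : H) :
  hdot (a *: c + d) e = a * hdot c e + hdot d e.
Proof.
rewrite -(hrepK c) -(hrepK d) -(hrepK e).
have -> : a *: hclass (hrepP c) + hclass (hrepP d) =
    hclass (scauchyD (scauchyZ a (hrepP c)) (hrepP d)).
  by rewrite -haddE -hscaleE.
have r1 := @hdot_cvg_Re _ _ (hrepP c) (hrepP e).
have i1 := @hdot_cvg_Im _ _ (hrepP c) (hrepP e).
have r2 := @hdot_cvg_Re _ _ (hrepP d) (hrepP e).
have i2 := @hdot_cvg_Im _ _ (hrepP d) (hrepP e).
apply: hdot_unique.
  rewrite ReD ReM; under eq_fun do rewrite sipDl sipZl ReD ReM.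
  exact: (cvgD (cvgB (cvgMl_tmp (a := complex.Re a) r1) (cvgMl_tmp (a := complex.Im a) i1)) r2).
rewrite ImD ImM; under eq_fun do rewrite sipDl sipZl ImD ImM.
exact: (cvgD (cvgD (cvgMl_tmp (a := complex.Re a) i1) (cvgMl_tmp (a := complex.Im a) r1)) i2).
Qed.

Lemma hdotC (c d : H) : hdot c d = (hdot d c)^*.
Proof.
rewrite -(hrepK c) -(hrepK d); apply: hdot_unique.
  rewrite Re_conj; under eq_fun do rewrite Re_sipC.
  exact: (@hdot_cvg_Re _ _ (hrepP d) (hrepP c)).
rewrite Im_conj; under eq_fun do rewrite sipC Im_conj.
exact: (cvgN (@hdot_cvg_Im _ _ (hrepP d) (hrepP c))).
Qed.

Lemma hdot_gt0 (c : H) : c != 0 -> 0 < hdot c c.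
Proof.
move=> c0; have h : 0 <= hdot c c.
  rewrite lecE; apply/andP; split.
    by apply/eqP; have := congr1 (@complex.Im _) (hdotC c c); rewrite Im_conj /=; lra.
  have hc := @hdot_cvg_Re _ _ (hrepP c) (hrepP c); rewrite hrepK in hc.
  apply: (cvgr_to_ge hc); apply: nearW => n.
  by have := sip_ge0 p (hrep c n); rewrite lecE => /andP[].
rewrite lt_def h andbT; apply: contra_neq c0 => h0.
rewrite -(hrepK c); apply/hclass_eq => e e0.
have := @hdot_cvg_Re _ _ (hrepP c) (hrepP c); rewrite hrepK h0 => /cvgrPdist_lt.
have e2 : 0 < e ^+ 2 by rewrite exprn_gt0.
move=> /(_ _ e2) [n _ hn]; exists n => k /hn /=.
rewrite sub0r normrN -sinorm_sqr ger0_norm ?sqr_ge0 // subr0 => h1.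
by rewrite -ltr_sqr ?nnegrE ?sinorm_ge0 // ltW.
Qed.

End HCompletion.

Section HComplete.
Context {R : realType}.
Local Notation C := R[i].
Variables (V : lmodType C) (p : semi_inner V).
Local Notation N := (sinorm p).
Local Notation H := (hcompletion p).

Lemma hdot_ge0 (c : H) : 0 <= hdot c c.
Proof.
have [->|/hdot_gt0/ltW//] := eqVneq c 0.
by have := hdotDZl (-1) 0 0 (0 : H); rewrite scaler0 addr0 mulN1r addNr => ->.
Qed.

Definition hsip : semi_inner H := SemiInner (@hdotDZl _ _ p) (@hdotC _ _ p) hdot_ge0.

Lemma hdot_linearr (c : H) : linear_for (Num.conj \; *%R) (hdot c).
Proof. by move=> a d e; have := sipDr hsip (a *: d) e c; rewrite sipZr. Qed.

Lemma hdot_herm (c d : H) : hdot c d = (-1) ^+ false * (hdot d c)^*.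
Proof. by rewrite expr0 mul1r hdotC. Qed.

HB.instance Definition _ := bilinear_isBilinear.Build C H H C
  *%R (Num.conj \; *%R) (@hdot _ _ p)
  ((fun u a c d => hdotDZl a c d u), hdot_linearr).
HB.instance Definition _ :=
  isHermitianSesquilinear.Build C H false Num.conj (@hdot _ _ p) hdot_herm.
HB.instance Definition _ :=
  isDotProduct.Build C H (@hdot _ _ p) (@hdot_gt0 _ _ p).

Lemma sinorm_hclass_le u (hu : scauchy p u) (b : R) n0 : 0 <= b ->
  (forall n, (n0 <= n)%N -> N (u n) <= b) -> sinorm hsip (hclass hu) <= b.
Proof.
move=> b0 h; rewrite -ler_sqr ?nnegrE ?sinorm_ge0 // sinorm_sqr.
have hc := @hdot_cvg_Re _ _ _ _ _ hu hu; apply: (cvgr_to_le hc).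
exists n0 => // n /= /h h1.
by rewrite -sinorm_sqr ler_sqr ?nnegrE ?sinorm_ge0.
Qed.

Definition hembed (v : V) : H := hclass (scauchy_cst p v).

Lemma sinorm_hembed v : sinorm hsip (hembed v) = N v.
Proof.
apply/eqP; rewrite eq_le; apply/andP; split.
  by apply: (@sinorm_hclass_le _ _ _ 0%N); rewrite ?sinorm_ge0.
rewrite -ler_sqr ?nnegrE ?sinorm_ge0 // !sinorm_sqr.
have hc := @hdot_cvg_Re _ _ _ _ _ (scauchy_cst p v) (scauchy_cst p v).
by apply: (cvgr_to_ge hc); exists 0%N.
Qed.

Lemma hclassB u v (hu : scauchy p u) (hv : scauchy p v) :
  hclass hu - hclass hv = hclass (scauchyD hu (scauchyN hv)).
Proof. by rewrite -haddE -hoppE. Qed.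

Lemma hcompletion_complete (c : nat -> H) :
  (forall e : R, 0 < e -> exists n0, forall n m, (n0 <= n)%N -> (n0 <= m)%N ->
     sinorm hsip (c n - c m) < e) ->
  exists l : H, forall e : R, 0 < e -> exists n0, forall n, (n0 <= n)%N ->
     sinorm hsip (c n - l) < e.
Proof.
move=> hc.
have hk k : exists v : V, sinorm hsip (c k - hembed v) <= k.+1%:R^-1.
  have k0 : 0 < k.+1%:R^-1 :> R by rewrite invr_gt0.
  have [n hn] := hrepP (c k) k0; exists (hrep (c k) n).
  rewrite -{1}[c k]hrepK hclassB; apply: (@sinorm_hclass_le _ _ _ n) => [|m hm].
    exact: ltW.
  by apply/ltW/hn.
have [v hv] := choice hk.
have small e : 0 < e -> exists n, forall k, (n <= k)%N -> k.+1%:R^-1 < e :> R.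
  move=> e0; exists (Num.truncn e^-1) => k hk'.
  rewrite invf_plt ?posrE //.
  apply: lt_le_trans (truncnS_gt _) _; by rewrite ler_nat ltnS.
have hN k l : N (v k - v l) = sinorm hsip (hembed (v k) - hembed (v l)).
  by rewrite -sinorm_hembed /hembed hclassB; congr (sinorm _ _); apply: hclass_ext.
have hvc : scauchy p v.
  move=> e e0; have e3 : 0 < e / 3 by rewrite divr_gt0.
  have [n hn] := hc _ e3; have [m hm] := small _ e3.
  exists (maxn n m) => k l; rewrite !geq_max => /andP[h1 h2] /andP[h3 h4].
  have t1 := sinorm_tri hsip (c k) (hembed (v k)) (hembed (v l)).
  have t2 := sinorm_tri hsip (c l) (c k) (hembed (v l)).
  rewrite hN; move: t1 t2 (hn _ _ h1 h3) (hv k) (hv l) (hm _ h2) (hm _ h4).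
  rewrite [sinorm hsip (hembed (v k) - c k)]sinormB.
  move: (k.+1%:R^-1) (l.+1%:R^-1) => x y.
  move: (sinorm hsip _) (sinorm hsip _) (sinorm hsip _) (sinorm hsip _) (sinorm hsip _) => *; lra.
exists (hclass hvc) => e e0; have e3 : 0 < e / 3 by rewrite divr_gt0.
have [n hn] := hvc _ e3; have [m hm] := small _ e3.
exists (maxn n m) => k; rewrite geq_max => /andP[h1 h2].
have t1 := sinorm_tri hsip (hembed (v k)) (c k) (hclass hvc).
have : sinorm hsip (hembed (v k) - hclass hvc) <= e / 3.
  rewrite /hembed hclassB; apply: (@sinorm_hclass_le _ _ _ n) => [|l hl].
    exact: ltW.
  by apply/ltW/hn.
move: t1 (hv k) (hm _ h2).
by move: (k.+1%:R^-1) => x; move: (sinorm hsip _) (sinorm hsip _) (sinorm hsip _) => *; lra.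
Qed.

End HComplete.

(* As everywhere in the library, inner products are linear in the first
   variable and conjugate-linear in the second. *)
Record hilbert (R : realType) := Hilbert {
  hs_car :> lmodType R[i];
  hs_dot : {dot hs_car for @Num.conj R[i]};
  hs_complete : forall u : nat -> hs_car,
    (forall e : R, 0 < e -> exists n0, forall n m, (n0 <= n)%N -> (n0 <= m)%N ->
       Num.sqrt (complex.Re (hs_dot (u n - u m) (u n - u m))) < e) ->
    exists l, forall e : R, 0 < e -> exists n0, forall n, (n0 <= n)%N ->
       Num.sqrt (complex.Re (hs_dot (u n - l) (u n - l))) < e }.

Definition hcompletion_hilbert (R : realType) (V : lmodType R[i])
    (p : semi_inner V) : hilbert R :=
  @Hilbert R (hcompletion p) (@hdot _ _ p) (@hcompletion_complete R V p).

Section Operators.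
Context {R : realType} {H : hilbert R}.
Local Notation dot := (hs_dot H).

Definition hnorm (v : H) : R := Num.sqrt (complex.Re (dot v v)).

Definition bounded_op (T : H -> H) : Prop :=
  linear T /\ exists c : R, forall v, hnorm (T v) <= c * hnorm v.

(* The default value is never used on bounded operators (Riesz). *)
Definition adjoint (T : H -> H) : H -> H :=
  xget (fun=> 0) [set S | forall u v, dot (T u) v = dot u (S v)].

(* Closure within B(H) for the strong operator topology. *)
Definition sot_closure (A : set (H -> H)) : set (H -> H) :=
  [set T | bounded_op T /\
    forall (s : seq H) (e : R), 0 < e ->
      exists2 S, A S & forall v, v \in s -> hnorm (T v - S v) < e].

(* Von Neumann algebras are concrete: SOT-closed unital *-subalgebras of B(H). *)
Record von_neumann (M : set (H -> H)) : Prop := {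
  vn_bounded : M `<=` bounded_op;
  vn_one : M idfun;
  vn_lin : forall a S T, M S -> M T -> M (fun v => a *: S v + T v);
  vn_comp : forall S T, M S -> M T -> M (S \o T);
  vn_adj : forall T, M T -> M (adjoint T);
  vn_sot : sot_closure M `<=` M }.

Definition vn_generated (y : H -> H) : set (H -> H) :=
  [set T | forall N, von_neumann N -> N y -> N T].

Definition op_le (S T : H -> H) : Prop := forall v, 0 <= dot (T v - S v) v.

(* tau preserves the suprema, taken in M, of upward directed families of
   positive elements of M. *)
Definition normal_on (M : set (H -> H)) (tau : (H -> H) -> R[i]) : Prop :=
  forall (D : set (H -> H)) (S : H -> H),
    D `<=` M -> D !=set0 -> (forall T, D T -> op_le (fun=> 0) T) ->
    (forall T1 T2, D T1 -> D T2 -> exists T3, [/\ D T3, op_le T1 T3 & op_le T2 T3]) ->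
    M S -> (forall T, D T -> op_le T S) ->
    (forall U, M U -> (forall T, D T -> op_le T U) -> op_le S U) ->
    complex.Re (tau S) = sup [set complex.Re (tau T) | T in D].

Record tracial_state (M : set (H -> H)) (tau : (H -> H) -> R[i]) : Prop := {
  ts_lin : forall a S T, M S -> M T ->
    tau (fun v => a *: S v + T v) = a * tau S + tau T;
  ts_one : tau idfun = 1;
  ts_ge0 : forall T, M T -> 0 <= tau (adjoint T \o T);
  ts_trace : forall S T, M S -> M T -> tau (S \o T) = tau (T \o S);
  ts_faithful : forall T, M T -> tau (adjoint T \o T) = 0 -> T = fun=> 0;
  ts_normal : normal_on M tau }.

Definition norm2 (tau : (H -> H) -> R[i]) (T : H -> H) : R :=
  Num.sqrt (complex.Re (tau (adjoint T \o T))).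

Definition op_ball (M : set (H -> H)) (r : R) : set (H -> H) :=
  [set T | M T /\ forall v, hnorm (T v) <= r * hnorm v].

End Operators.

Record tracial_vna (R : realType) := TracialVNA {
  tv_space : hilbert R;
  tv_alg : set (tv_space -> tv_space);
  tv_trace : (tv_space -> tv_space) -> R[i];
  tv_vn : von_neumann tv_alg;
  tv_state : tracial_state tv_alg tv_trace }.

Arguments tv_alg {R} M : rename.
Arguments tv_trace {R} M : rename.

(* C^*<(T_i)_i> is the algebra of the free monoid on the letters T_i, encoded
   as (i, false), and T_i^*, encoded as (i, true). *)
Definition word (I : Type) : Type := seq (I * bool).

HB.instance Definition _ (I : choiceType) := Choice.on (word I).

Lemma word_unit (I : choiceType) (x y : word I) :
  x ++ y = [::] -> x = [::] /\ y = [::].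
Proof. by case: x. Qed.

HB.instance Definition _ (I : choiceType) := Choice_isMonomialDef.Build (word I)
  (@catA _) (@cat0s _) (@cats0 _) (@word_unit I).

Notation ncpoly R I := (malg (word I) R[i]).

Section NCPoly.
Context {R : realType} {I : choiceType}.

Definition ncvar (i : I) : ncpoly R I := mkmalgU ([:: (i, false)] : word I) 1.

Definition star_word (w : word I) : word I := rev [seq (a.1, ~~ a.2) | a <- w].

Definition ncstar (P : ncpoly R I) : ncpoly R I :=
  \sum_(w <- msupp P) mkmalgU (star_word w) (mcoeff w P)^*.

Lemma star_wordK : involutive star_word.
Proof.
move=> w; rewrite /star_word map_rev revK -map_comp -[RHS]map_id.
by apply: eq_map => -[i b] /=; rewrite negbK.
Qed.

Lemma mcoeff_ncstar w P : mcoeff w (ncstar P) = (mcoeff (star_word w) P)^*.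
Proof.
rewrite /ncstar raddf_sum /=.
under eq_bigr do rewrite mcoeffU.
have [h|h] := boolP (star_word w \in msupp P).
  rewrite (big_fsetD1 _ h) /= star_wordK eqxx mulr1n big_seq big1 ?addr0 // => v.
  rewrite !inE => /andP[hv _]; case: eqP => // e.
  by rewrite -e star_wordK eqxx in hv.
rewrite mcoeff_outdom // rmorph0 big_seq big1 // => v hv.
by case: eqP => // e; rewrite -e star_wordK hv in h.
Qed.

Lemma ncstarD P Q : ncstar (P + Q) = ncstar P + ncstar Q.
Proof.
by apply/malgP => w; rewrite mcoeffD !mcoeff_ncstar mcoeffD rmorphD.
Qed.

Lemma ncstarZ a P : ncstar (a *: P) = a^* *: ncstar P.
Proof.
by apply/malgP => w; rewrite mcoeffZ !mcoeff_ncstar mcoeffZ rmorphM.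
Qed.

Lemma ncmulrAr a (P Q : ncpoly R I) : P * (a *: Q) = a *: (P * Q).
Proof.
have -> : P * (a *: Q) = P * mkmalgU (mone : word I) a * Q.
  by rewrite -mulrA mul_malgC.
rewrite scalerAl; congr (_ * Q).
rewrite malgM_def malgZ_def fgmulgU.
by apply: eq_bigr => w _; rewrite mulrC mulm1.
Qed.

(* The subset topology of pointwise convergence is the weak* topology.  In
   R[i], z <= w means that w - z is real and nonnegative. *)
Definition Sigma (rad : I -> R) : set {ptws ncpoly R I -> R[i]^o} :=
  [set l | [/\ scalar (l : ncpoly R I -> R[i]),
     l 1 = 1,
     forall P Q, l (P * Q) = l (Q * P),
     forall P, (0 : R[i]) <= l (ncstar P * P) &
     forall i k, (l ((ncstar (ncvar i) * ncvar i) ^+ k) : R[i]) <=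
       (rad i ^+ (2 * k))%:C%C]].

Section Evaluation.
Context {H : hilbert R}.
Implicit Types (tau : (H -> H) -> R[i]) (x : I -> H -> H).

Definition word_op x (w : word I) : H -> H :=
  foldr (fun a T => (if a.2 then adjoint (x a.1) else x a.1) \o T) idfun w.

Definition ncpoly_op x (P : ncpoly R I) : H -> H :=
  fun v => \sum_(w <- msupp P) mcoeff w P *: word_op x w v.

Definition law_of tau x : {ptws ncpoly R I -> R[i]^o} :=
  fun P => tau (ncpoly_op x P).

End Evaluation.

Section FR.
Variable rad : I -> R.

Definition csigma : Type := continuousType (Sigma rad) R[i]^o.
HB.instance Definition _ := Choice.on csigma.

Lemma csigma_add_subproof (f g : csigma) : continuous (fun l => f l + g l).
Proof. by move=> l; exact: cvgD (@cts_fun _ _ f l) (@cts_fun _ _ g l). Qed.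
Lemma csigma_opp_subproof (f : csigma) : continuous (fun l => - f l).
Proof. by move=> l; exact: cvgN (@cts_fun _ _ f l). Qed.
Lemma csigma_zero_subproof : continuous (fun _ : Sigma rad => 0 : R[i]^o).
Proof. exact: cst_continuous. Qed.

Definition csigma_add (f g : csigma) : csigma := mkcts (@csigma_add_subproof f g).
Definition csigma_opp (f : csigma) : csigma := mkcts (@csigma_opp_subproof f).
Definition csigma_zero : csigma := mkcts csigma_zero_subproof.

Lemma csigma_addA : associative csigma_add.
Proof. by move=> f g h; apply/continuousEP => l /=; rewrite /mkcts /= addrA. Qed.
Lemma csigma_addC : commutative csigma_add.
Proof. by move=> f g; apply/continuousEP => l /=; rewrite /mkcts /= addrC. Qed.
Lemma csigma_add0 : left_id csigma_zero csigma_add.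
Proof. by move=> f; apply/continuousEP => l /=; rewrite /mkcts /= add0r. Qed.
Lemma csigma_addN : left_inverse csigma_zero csigma_opp csigma_add.
Proof. by move=> f; apply/continuousEP => l /=; rewrite /mkcts /= addNr. Qed.

HB.instance Definition _ := GRing.isZmodule.Build csigma
  csigma_addA csigma_addC csigma_add0 csigma_addN.

(* C(Sigma_R) (x) C^*<(T_i)_i> as the free C(Sigma_R)-module on the words: an
   element is a finite sum of phi_w (x) w. *)
Definition AR := malg (word I) csigma.
HB.instance Definition _ := GRing.Zmodule.on AR.

(* phi (x) w takes the value phi(l_x) w(x).  The functional l_x belongs to
   Sigma_R for x in a tracial von Neumann algebra with |x_i| <= R_i, so that the
   default value 0 of 'valL_0 plays no role there. *)
Section AREval.
Context {H : hilbert R}.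
Implicit Types (tau : (H -> H) -> R[i]) (x : I -> H -> H).

Definition AR_op tau x (f : AR) : H -> H :=
  fun v => \sum_(w <- msupp f)
    'valL_(0 : R[i]^o) (mcoeff w f : Sigma rad -> R[i]^o) (law_of tau x) *: word_op x w v.
End AREval.

Definition normR2 (f : AR) : \bar R :=
  ereal_sup [set r | exists (M : tracial_vna R) (x : I -> tv_space M -> tv_space M),
    (forall i, op_ball (tv_alg M) (rad i) (x i)) /\
    r = (norm2 (tv_trace M) (AR_op (tv_trace M) x f))%:E].

Definition FR2 : Type := completion [set: AR] normR2.

Definition FR2_dist (F G : FR2) : \bar R := cdist normR2 (val F) (val G).

(* Evaluation of F at a tuple x in (M, tau): a class of sequences in M, that is
   an element of L^2(M, tau), in which y in M embeds as the class of the
   constant sequence.  The definitions make sense for all data (M, tau); they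
   are only used for tracial von Neumann algebras. *)
Section FREval.
Context {H : hilbert R}.
Variables (M : set (H -> H)) (tau : (H -> H) -> R[i]) (x : I -> H -> H).

Local Notation L2cls := (cauchy_class M (fun T => (norm2 tau T)%:E)).

Definition FR2_eval (F : FR2) : set (nat -> H -> H) :=
  L2cls (fun n => AR_op tau x (reprc (val F) n)).

(* F(x) = y with y in M. *)
Definition FR2_value (F : FR2) (y : H -> H) : Prop :=
  M y /\ FR2_eval F = embed M (fun T => (norm2 tau T)%:E) y.

(* The operator norm of F(x), equal to +oo (the infimum of the empty set) if
   F(x) is not in M. *)
Definition FR2_opnorm (F : FR2) : \bar R :=
  ereal_inf [set r%:E | r in [set r : R | 0 <= r /\
    exists2 y, FR2_value F y & forall v, hnorm (y v) <= r * hnorm v]].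

End FREval.

Definition normR (F : FR2) : \bar R :=
  ereal_sup [set r | exists (M : tracial_vna R) (x : I -> tv_space M -> tv_space M),
    (forall i, op_ball (tv_alg M) (rad i) (x i)) /\
    r = FR2_opnorm (tv_alg M) (tv_trace M) x F].

Definition FR : set FR2 := [set F | (normR F < +oo)%E].

End FR.

Section GNS.
Variables (rad : I -> R) (l : Sigma rad).
Local Notation lam := (val l : ncpoly R I -> R[i]).

(* <[P], [Q]> = l(Q^* P), in keeping with linearity in the first variable. *)
Definition law_form (P Q : ncpoly R I) : R[i] := lam (ncstar Q * P).

Lemma law_lin a P Q : lam (a *: P + Q) = a * lam P + lam Q.
Proof. by have [h _ _ _ _] := set_mem (valP l); apply: h. Qed.

Lemma law_formDZl a P Q S :
  law_form (a *: P + Q) S = a * law_form P S + law_form Q S.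
Proof.
by rewrite /law_form -law_lin mulrDr ncmulrAr.
Qed.

Lemma law_formDZr a P Q S :
  law_form S (a *: P + Q) = a^* * law_form S P + law_form S Q.
Proof. by rewrite /law_form -law_lin ncstarD ncstarZ mulrDl scalerAl. Qed.

Lemma law_form_ge0 P : 0 <= law_form P P.
Proof. by have [_ _ _ h _] := set_mem (valP l); apply: h. Qed.

Lemma law_formC P Q : law_form P Q = (law_form Q P)^*.
Proof.
have Im0 S : complex.Im (law_form S S) = 0.
  by have := law_form_ge0 S; rewrite lecE => /andP[/eqP ->].
have h a : complex.Im (a * law_form P Q + a^* * law_form Q P) = 0.
  have := Im0 (a *: P + Q); rewrite law_formDZl !law_formDZr.
  move: (Im0 P) (Im0 Q); case: (law_form P P) (law_form Q Q) => [x ?] [y ?] /= -> ->.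
  by case: (law_form P Q) (law_form Q P) a => [b c] [d e] [f g] /= h; lra.
have h1 := h 1; have hi := h 'i%C; move: h1 hi.
case: (law_form P Q) (law_form Q P) => [a b] [c d] /= h1 h2.
by congr Complex; lra.
Qed.

Definition law_sip : semi_inner (ncpoly R I) :=
  SemiInner law_formDZl law_formC law_form_ge0.

Definition L2law : hilbert R := hcompletion_hilbert law_sip.

Definition L2cls (P : ncpoly R I) : L2law := hembed law_sip P.

(* The bounded operator pi_l(P) on L^2(l) with pi_l(P)[Q] = [PQ]; it exists, and
   is unique by density of the [Q]. *)
Definition gns (P : ncpoly R I) : L2law -> L2law :=
  xget (fun=> 0) [set T | bounded_op T /\ forall Q, T (L2cls Q) = L2cls (P * Q)].

Definition gns_var (i : I) : L2law -> L2law := gns (ncvar i).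

Definition law_vna : set (L2law -> L2law) := sot_closure (range gns).

Definition law_trace (T : L2law -> L2law) : R[i] :=
  hs_dot L2law (T (L2cls 1)) (L2cls 1).

End GNS.
End NCPoly.

Arguments FR {R I} rad.
Arguments law_vna {R I rad} l.
Arguments law_trace {R I rad} l.
Arguments gns_var {R I rad} l.

(* Main.v *)
(* For points x, -x of C^I with |x_k| <= R_k and x <> 0, the law
   l_x(P) = (P(x) + P(-x)) / 2 has L^2(l_x) = C^2 and W^*(l_x) = the diagonal
   matrices, so that f_l(theta_l) = diag(a, b) at l = l_x, and W^*(f_l(theta_l))
   is a proper subalgebra when a = b.  Replacing x by -x leaves l_x unchanged and
   exchanges a and b, hence x |-> a - b is an odd continuous function with values
   in C.  Two variables with positive radius leave room for a 2-sphere of such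
   points, on which a - b vanishes somewhere by the Borsuk-Ulam theorem: otherwise
   the loop of its values along the equator, which has odd winding number, would
   be contracted in C \ {0} by the values on a hemisphere. *)
From HB Require Import structures.
Require Import Defs.
From mathcomp Require Import all_boot all_order all_algebra finmap sesquilinear.
From mathcomp Require Import all_classical all_reals all_analysis.
From mathcomp Require Import complex ring lra.
From mathcomp Require Import -(notations) monalg.
Set Implicit Arguments.
Unset Strict Implicit.
Unset Printing Implicit Defensive.
Import Order.TTheory GRing.Theory Num.Theory numFieldNormedType.Exports.
Import Defs.
Local Open Scope classical_set_scope.
Local Open Scope ring_scope.

(** The law l_x knows only the unordered pair {x, -x}, so an entry of the diagonal operator has a
    name only once a point is labelled. Each entry is therefore attached to a labelled point, as a
    limit of scalars ([FR_val]) that does not mention L^2(l_x), a space which changes with x.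
    Continuity of the entries comes from the norm: the supremum defining ||.||_{R,2} includes the
    evaluation at every two-point law, where it dominates each entry up to a constant. Near a given
    x, one element of the algebraic tensor product thus approximates the entries uniformly, and its
    own entries are polynomial expressions with continuous coefficients. Two positive radii are the
    threshold. If only R_i is positive, f_l = T_i generates W^*(l) for every l; on the circle |x| =
    R_i the odd map a - b is then 2x, without zeros. The winding number is discrete, a sum of angles
    along a fine grid, so that neither path lifting nor integrality is used. *)

(** * Oriented angles between plane vectors *)

Section Angle.
Context {R : realType}.
Implicit Types a b c : R * R.

(** In complex notation, [pdot a b] and [pcross a b] are the real and imaginary parts of conj(a)
    b. *)
Definition pdot a b : R := a.1 * b.1 + a.2 * b.2.
Definition pcross a b : R := a.1 * b.2 - a.2 * b.1.
(* Meaningful only when 0 < pdot a b, that is, less than a right angle apart. *)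
Definition angle a b : R := atan (pcross a b / pdot a b).

Lemma cos_gt0_half (x : R) : -pi < x < pi -> 0 < cos x -> - (pi / 2) < x < pi / 2.
Proof.
move=> /andP[h1 h2] cx; rewrite !ltNge; apply/andP; split; apply/negP => h.
  have : cos (x + pi) = - cos x by exact: cosDpi.
  have : 0 <= cos (x + pi) by apply: cos_ge0_pihalf; lra.
  by lra.
have : cos (x - pi) = - cos x.
  by have := cosDpi (x - pi); rewrite subrK => ->; rewrite opprK.
have : 0 <= cos (x - pi) by apply: cos_ge0_pihalf; lra.
by lra.
Qed.

(** The bound [s * t < 1] makes the cosine of the sum positive, which confines the sum to the
    interval where [atan] inverts [tan]. *)
Lemma atanD (s t : R) : s * t < 1 -> atan s + atan t = atan ((s + t) / (1 - s * t)).
Proof.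
move=> st; have cs := cos_gt0_pihalf (proj1 (atan_def s)).
have ct := cos_gt0_pihalf (proj1 (atan_def t)).
have ts := proj2 (atan_def s); have tt := proj2 (atan_def t).
have c0 : 0 < cos (atan s + atan t).
  have ss : sin (atan s) = s * cos (atan s) by rewrite -{2}ts /tan mulfVK // gt_eqF.
  have st' : sin (atan t) = t * cos (atan t) by rewrite -{2}tt /tan mulfVK // gt_eqF.
  rewrite cosD ss st' (_ : _ - _ = cos (atan s) * cos (atan t) * (1 - s * t)); last by ring.
  by rewrite !mulr_gt0 // subr_gt0.
have /andP[s1 s2] := proj1 (atan_def s); have /andP[t1 t2] := proj1 (atan_def t).
have hb : - (pi / 2) < atan s + atan t < pi / 2 by apply: cos_gt0_half c0; lra.
rewrite -(tanK (x := atan s + atan t)) ?in_itv //=.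
by rewrite tanD ?gt_eqF // ts tt.
Qed.

Lemma pdotC a b : pdot a b = pdot b a.
Proof. by rewrite /pdot mulrC [a.2 * _]mulrC. Qed.

Lemma pdot_gt0 a : a != 0 -> 0 < pdot a a.
Proof.
move=> a0; rewrite lt_def; apply/andP; split; last by rewrite addr_ge0 // -expr2 sqr_ge0.
apply: contra a0 => /eqP/eqP; rewrite paddr_eq0 -?expr2 ?sqr_ge0 // !sqrf_eq0.
by case: a => a1 a2 /= /andP[/eqP -> /eqP ->].
Qed.

Lemma pdot_self_gt0 a b : 0 < pdot a b -> 0 < pdot a a.
Proof.
move=> ab; apply: pdot_gt0; apply: contraTneq ab => ->.
by rewrite /pdot !mul0r addr0 ltxx.
Qed.

(** Angles add exactly, not just modulo pi, because the third hypothesis keeps the sum below a right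
    angle. The identity [e] comes from (conj(a) b)(conj(b) c) = |b|^2 conj(a) c; its right-hand side
    is positive, as [atanD] requires. *)
Lemma angle_add a b c : 0 < pdot a b -> 0 < pdot b c -> 0 < pdot a c ->
  angle a b + angle b c = angle a c.
Proof.
move=> ab bc ac; rewrite /angle.
have bb : 0 < pdot b b by apply: (@pdot_self_gt0 b a); rewrite pdotC.
have e : 1 - pcross a b / pdot a b * (pcross b c / pdot b c) =
    pdot b b * pdot a c / (pdot a b * pdot b c).
  rewrite /pcross; move: (lt0r_neq0 ab) (lt0r_neq0 bc); rewrite /pdot => h1 h2.
  by field; rewrite h1 h2.
rewrite atanD; last by rewrite -subr_gt0 e !(divr_gt0, mulr_gt0).
congr atan; rewrite e.
move: (lt0r_neq0 ab) (lt0r_neq0 bc) (lt0r_neq0 ac) (lt0r_neq0 bb).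
by rewrite /pcross /pdot => h1 h2 h3 h4; field; rewrite h1 h2 h3 h4.
Qed.

Lemma angle_opp a b : angle (- a) (- b) = angle a b.
Proof. by congr atan; rewrite /pcross /pdot /= !mulrNN. Qed.

Lemma angle_refl a : angle a a = 0.
Proof. by rewrite /angle (_ : pcross a a = 0) ?mul0r ?atan0 // /pcross; ring. Qed.

Definition rotate (t : R) a : R * R :=
  (cos t * a.1 - sin t * a.2, sin t * a.1 + cos t * a.2).

Lemma rotateD s t a : rotate s (rotate t a) = rotate (t + s) a.
Proof. by rewrite /rotate /= cosD sinD; congr pair; ring. Qed.

Lemma rotateZ s r a : rotate s (r *: a) = r *: rotate s a.
Proof. by rewrite /rotate /=; congr pair; rewrite /= /GRing.scale /=; ring. Qed.

Lemma rotate0 a : rotate 0 a = a.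
Proof. by rewrite /rotate cos0 sin0 !mul1r !mul0r subr0 add0r -surjective_pairing. Qed.

Lemma rotate_angle a b : 0 < pdot a b -> exists2 r, 0 < r & b = r *: rotate (angle a b) a.
Proof.
move=> ab; have c0 := cos_gt0_pihalf (proj1 (atan_def (pcross a b / pdot a b))).
have tE := proj2 (atan_def (pcross a b / pdot a b)).
have sE : sin (angle a b) = pcross a b / pdot a b * cos (angle a b).
  by rewrite -{1}tE /tan mulfVK // gt_eqF.
have aa := pdot_self_gt0 ab.
(* This is |b| / |a| without square roots, since a.b = |a| |b| cos. *)
exists (pdot a b / (pdot a a * cos (angle a b))); first by rewrite divr_gt0 // mulr_gt0.
rewrite /rotate sE; move: (lt0r_neq0 c0); rewrite -/(angle a b).
move: (cos _) (lt0r_neq0 ab) (lt0r_neq0 aa) => k; case: a b {ab c0 tE sE aa} => [a1 a2] [b1 b2].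
rewrite /pcross /pdot /= => h1 h2 h3; congr pair; rewrite /= /GRing.scale /=;
  by field; rewrite h1 h2 h3.
Qed.

End Angle.

(** * Winding of the rows of a grid of plane vectors *)

Section DiscreteWinding.
Context {R : realType}.
Variables (N : nat) (z : nat -> nat -> R * R).
Local Notation M := (N + N)%N.
(** Diagonal neighbours are included because the two triangles of a cell share its diagonal. The
    indices [k'] and [j'] may leave the grid by one. *)
Hypothesis close : forall k j k' j', (k <= N)%N -> (j <= M)%N -> (k <= k' <= k.+1)%N ->
  (j <= j' <= j.+1)%N -> 0 < pdot (z k j) (z k' j').

Definition row_winding k := \sum_(0 <= j < M) angle (z k j) (z k j.+1).

(** In each cell, both ways round to the opposite corner add up to the angle of the diagonal. The
    rows thus differ by a telescoping sum of angles of vertical edges, whose two ends agree because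
    both rows are closed. *)
Lemma row_winding_step k : (k < N)%N -> z k M = z k 0%N -> z k.+1 M = z k.+1 0%N ->
  row_winding k = row_winding k.+1.
Proof.
move=> kN z1 z2; apply/eqP; rewrite -subr_eq0 -sumrB.
pose v j := - angle (z k j) (z k.+1 j).
rewrite (_ : \sum_(_ <= _ < _) _ = \sum_(0 <= j < M) (v j.+1 - v j)).
  by rewrite telescope_sumr // /v z1 z2 subrr.
apply: eq_big_nat => j /= jM; rewrite /v.
have h1 : angle (z k j) (z k j.+1) + angle (z k j.+1) (z k.+1 j.+1) = angle (z k j) (z k.+1 j.+1).
  by apply: angle_add; apply: close; rewrite ?leqnn ?leqnSn // ?(ltnW kN) // ?(ltnW jM).
have h2 : angle (z k j) (z k.+1 j) + angle (z k.+1 j) (z k.+1 j.+1) = angle (z k j) (z k.+1 j.+1).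
  by apply: angle_add; apply: close; rewrite ?leqnn ?leqnSn // ?(ltnW kN) // ?(ltnW jM).
by lra.
Qed.

Lemma row_direction k n : (k <= N)%N -> (n <= M)%N -> exists2 r, 0 < r &
  z k n = r *: rotate (\sum_(0 <= j < n) angle (z k j) (z k j.+1)) (z k 0%N).
Proof.
move=> kN; elim: n => [_|n IH nM].
  by exists 1; rewrite ?ltr01 // big_geq // rotate0 scale1r.
have [r r0 e] := IH (ltnW nM).
have [s s0 es] : exists2 s, 0 < s & z k n.+1 = s *: rotate (angle (z k n) (z k n.+1)) (z k n).
  by apply: rotate_angle; apply: close; rewrite ?leqnn ?leqnSn // ltnW.
exists (s * r); first exact: mulr_gt0.
rewrite big_nat_recr //=; set t := angle (z k n) (z k n.+1) in es *.
by rewrite es e rotateZ rotateD scalerA.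
Qed.

(** All rows inherit winding 0 from the constant row 0. On row [N] the two halves turn by the same
    angle [S], so [S = 0]; then [- z N 0] is a positive multiple of [z N 0], which must vanish,
    against [close] at a single point. *)
Lemma odd_loop_not_contractible :
  (forall j, z 0%N j = z 0%N 0%N) -> (forall k, z k M = z k 0%N) ->
  (forall j, z N (N + j)%N = - z N j) -> False.
Proof.
move=> z0 zp zo.
have W k : (k <= N)%N -> row_winding k = 0.
  elim: k => [_|k IH kN]; last by rewrite -row_winding_step // IH // ltnW.
  by rewrite /row_winding big1 // => j _; rewrite (z0 j) (z0 j.+1) angle_refl.
have := W N (leqnn _); rewrite /row_winding (big_cat_nat (n := N)) //= ?leq_addr //.
have -> : \sum_(N <= j < M) angle (z N j) (z N j.+1) =
    \sum_(0 <= j < N) angle (z N j) (z N j.+1).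
  rewrite -[X in \sum_(X <= _ < _) _]add0n big_addn addnK; apply: eq_bigr => j _.
  by rewrite -addSn ![(_ + N)%N]addnC !zo angle_opp.
set S := \sum_(_ <= _ < _) _ => S2; have S0 : S = 0 by lra.
have [r r0] := row_direction (leqnn N) (leq_addr N N); rewrite -/S S0 rotate0.
have := zo 0%N; rewrite addn0 => -> e.
have /eqP : (r + 1) *: z N 0%N = 0 by rewrite scalerDl scale1r -e addNr.
rewrite scaler_eq0 gt_eqF ?addr_gt0 ?ltr01 //= => /eqP zN0.
have := close (leqnn N) (leq0n _) (j' := 0) (k' := N); rewrite leqnn leqnSn => /(_ isT isT).
by rewrite zN0 /pdot !mulr0 addr0 ltxx.
Qed.

End DiscreteWinding.

(** * Borsuk-Ulam on a hemisphere in polar coordinates *)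

Section PlanarBorsukUlam.
Context {R : realType}.
Variables (u v : R * R -> R).
Hypotheses (uc : continuous u) (vc : continuous v).
Local Notation h p := (u p, v p).

(** Positivity of [pdot (h p) (h q)] is an open condition that holds on the diagonal; compactness of
    [0, 1] x [0, 2] yields one mesh for all [p]. The point [q] may lie outside the rectangle, since
    grid neighbours may. *)
Lemma close_grid : (forall p, h p != 0) ->
  exists N, forall p q, 0 <= p.1 <= 1 -> 0 <= p.2 <= 2 ->
    `|p.1 - q.1| <= N.+1%:R^-1 -> `|p.2 - q.2| <= N.+1%:R^-1 -> 0 < pdot (h p) (h q).
Proof.
move=> h0; pose K : set (R * R) := `[0, 1] `*` `[0, 2].
have cK : compact K by apply: compact_setX; exact: segment_compact.
pose P (N : nat) (p : R * R) := forall q, `|p.1 - q.1| <= N.+1%:R^-1 ->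
  `|p.2 - q.2| <= N.+1%:R^-1 -> 0 < pdot (h p) (h q).
have := (compact_near_coveringP K).1 cK nat \oo P _.
case=> [p Kp|N _ /(_ N (leqnn _)) hN]; last first.
  by exists N => p q p1 p2; apply: hN; split; rewrite /= in_itv.
have F0 : 0 < pdot (h p) (h p) := pdot_gt0 (h0 p).
have Fc : (fun pq : (R * R) * (R * R) => pdot (h pq.1) (h pq.2)) @ (p, p) --> pdot (h p) (h p).
  by apply: cvgD; apply: cvgM; apply: continuous_comp;
    (exact: cvg_fst || exact: cvg_snd || exact: uc || exact: vc).
have := cvgr_gt _ Fc _ F0; case=> -[A B] /= [nA nB] AB.
have [d /= d0 dA] : exists2 d : R, 0 < d & ball p d `<=` A `&` B.
  by have : nbhs p (A `&` B) by [exact: filterI]; rewrite -nbhs_ballE.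
(* Half of [d] is spent between [p] and [q], the other half between [q] and [r]. *)
have d2 : 0 < d / 2 by rewrite divr_gt0.
near=> q N => r qr1 qr2.
have bq : ball p (d / 2) q by near: q; exact: nbhsx_ballx.
have hN : N.+1%:R^-1 < d / 2.
  by near: N; exact: near_infty_natSinv_lt (PosNum d2).
have [Aq _] : (A `&` B) q by apply: dA; apply: le_ball bq; lra.
suff [_ Br] : (A `&` B) r by exact: (AB (q, r)).
apply: dA; case: bq => /= b1 b2; rewrite /= in qr1 qr2.
split; rewrite /ball /= in b1 b2 *.
  apply: le_lt_trans (ler_distD q.1 _ _) _.
  by rewrite [d]splitr ltrD // (le_lt_trans qr1).
apply: le_lt_trans (ler_distD q.2 _ _) _.
by rewrite [d]splitr ltrD // (le_lt_trans qr2).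
Unshelve. all: by end_near.
Qed.

Lemma planar_borsuk_ulam :
  (forall t, h (0, t) = h (0, 0)) -> (forall s, h (s, 2) = h (s, 0)) ->
  (forall t, h (1, 1 + t) = - h (1, t)) -> exists p, h p = 0.
Proof.
move=> z0 zp zo; apply: contrapT => nz.
have h0 p : h p != 0 by apply/eqP => e; apply: nz; exists p.
have [N hN] := close_grid h0.
(* With mesh 1/(N+1), row N+1 is the boundary s = 1, columns 0 to 2(N+1) cover one period, and N+1
   columns shift t by 1. *)
pose P k j : R * R := (k%:R / N.+1%:R, j%:R / N.+1%:R).
have n0 : 0 < N.+1%:R :> R by rewrite ltr0n.
have P0 m : 0 <= m%:R / N.+1%:R :> R by rewrite divr_ge0 ?ler0n.
have P1 m : (m <= N.+1)%N -> m%:R / N.+1%:R <= 1 :> R.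
  by move=> mN; rewrite ler_pdivrMr // mul1r ler_nat.
have P2 m : (m <= N.+1 + N.+1)%N -> m%:R / N.+1%:R <= 2 :> R.
  by move=> mN; rewrite ler_pdivrMr // mulr_natl mulr2n -natrD ler_nat.
have step m m' : (m <= m' <= m.+1)%N -> `|m%:R / N.+1%:R - m'%:R / N.+1%:R| <= N.+1%:R^-1 :> R.
  move=> /andP[m1 m2]; rewrite distrC -mulrBl normrM [X in _ * X <= _]ger0_norm ?invr_ge0 ?ler0n //.
  rewrite ler_piMl ?invr_ge0 ?ler0n // -natrB // normr_nat.
  by rewrite -[1]/(1%:R) ler_nat leq_subLR addn1.
apply: (@odd_loop_not_contractible R N.+1 (fun k j => h (P k j))).
- move=> k j k' j' kN jN kk jj; apply: hN; rewrite /P /= ?P0 ?P1 ?P2 //; exact: step.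
- by move=> j; rewrite /P !mul0r.
- move=> k; rewrite /P mul0r (_ : (N.+1 + N.+1)%:R / _ = 2) //.
  by rewrite natrD mulrDl divff ?gt_eqF.
- move=> j; rewrite /P divff ?gt_eqF // natrD mulrDl divff ?gt_eqF //; exact: zo.
Qed.

End PlanarBorsukUlam.

(** * Inner products, orthogonality to dense sets, adjoints *)

Section HilbertSip.
Context {R : realType} (H : hilbert R).
Local Notation C := R[i].
Local Notation dot := (hs_dot H).

Lemma hs_dotDZl a (u v w : H) : dot (a *: u + v) w = a * dot u w + dot v w.
Proof. by rewrite linearPl. Qed.

Lemma hs_dotC (u v : H) : dot u v = (dot v u)^*.
Proof. by rewrite hermC expr0 mul1r. Qed.

Lemma hs_dot_gt0 (u : H) : u != 0 -> 0 < dot u u.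
Proof. exact: neq0_dnorm_gt0. Qed.

Lemma hs_dot_ge0 (u : H) : 0 <= dot u u.
Proof.
have [->|/hs_dot_gt0/ltW//] := eqVneq u 0.
by rewrite linear0l.
Qed.

Definition hilbert_sip : semi_inner H := SemiInner hs_dotDZl hs_dotC hs_dot_ge0.

Lemma hs_dotDl (u v w : H) : dot (u + v) w = dot u w + dot v w.
Proof. exact: (sipDl hilbert_sip). Qed.

Lemma hs_dotBl (u v w : H) : dot (u - v) w = dot u w - dot v w.
Proof. exact: (sipBl hilbert_sip). Qed.

Lemma hs_dotZl a (u w : H) : dot (a *: u) w = a * dot u w.
Proof. exact: (sipZl hilbert_sip). Qed.

Lemma hs_dotDr (u v w : H) : dot w (u + v) = dot w u + dot w v.
Proof. exact: (sipDr hilbert_sip). Qed.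

Lemma hs_dotZr a (u w : H) : dot w (a *: u) = a^* * dot w u.
Proof. exact: (sipZr hilbert_sip). Qed.

Lemma hs_dot_lin2r a b (u v w : H) :
  dot w (a *: u + b *: v) = a^* * dot w u + b^* * dot w v.
Proof. by rewrite hs_dotDr !hs_dotZr. Qed.

Lemma hs_dot_inj (u v : H) : (forall w, dot w u = dot w v) -> u = v.
Proof.
move=> h; apply/eqP; rewrite -subr_eq0; apply/negP => /negP /hs_dot_gt0.
rewrite [X in _ < X](sipBr hilbert_sip u v (u - v)) /=.
by rewrite h subrr ltxx.
Qed.

(** If [v] is orthogonal to [c], Pythagoras gives |c| <= |c - v|, so that |c| <= e for every [e]. *)
Lemma hs_dense_orthogonal (c : H) (A : set H) :
  (forall e, 0 < e -> exists2 v, A v & hnorm (c - v) <= e) ->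
  (forall v, A v -> dot c v = 0) -> c = 0.
Proof.
move=> hA h; apply/eqP; apply: contraT => /hs_dot_gt0 c0.
suff c_le0 : hnorm c <= 0.
  have e1 : hnorm c ^+ 2 = complex.Re (dot c c) := sinorm_sqr hilbert_sip c.
  have z : hnorm c = 0 by apply/eqP; rewrite eq_le c_le0 sqrtr_ge0.
  by move: c0; rewrite ltcE -e1 z expr0n /= ltxx andbF.
apply/ler_addgt0Pr => e e0; rewrite add0r; have [v Av hv] := hA e e0.
apply: le_trans hv; rewrite -ler_sqr ?nnegrE ?sqrtr_ge0 //.
rewrite [leRHS](sinorm_sqrD hilbert_sip c (- v)) (sipNr hilbert_sip) /= h //.
by rewrite oppr0 mulr0 addr0 lerDl sqr_ge0.
Qed.

Lemma adjoint_unique (T S : H -> H) :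
  (forall u v, dot (T u) v = dot u (S v)) -> adjoint T = S.
Proof.
move=> h; apply/funext => v; apply: hs_dot_inj => u; rewrite -h.
have hx : [set S | forall u v, dot (T u) v = dot u (S v)] (adjoint T).
  by apply: xgetPex; exists S.
by rewrite hx.
Qed.

End HilbertSip.

(** * Squared moduli, and diagonal operators on a two-dimensional space *)

Section NormSquare.
Context {R : realType}.
Local Notation C := R[i].
Implicit Types z w : C.

(** Real-valued, unlike the norm of [C], so that [lra] and [nra] apply. *)
Definition nsq z : R := complex.Re (z * z^*).

Lemma nsqE z : nsq z = complex.Re z ^+ 2 + complex.Im z ^+ 2.
Proof. by case: z => x y; rewrite /nsq /=; ring. Qed.

Lemma mulcJ_nsq z : z * z^* = (nsq z)%:C%C.
Proof. by rewrite nsqE; case: z => x y /=; congr Complex; ring. Qed.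

Lemma nsq_ge0 z : 0 <= nsq z.
Proof. by rewrite nsqE addr_ge0 ?sqr_ge0. Qed.

Lemma nsqM z w : nsq (z * w) = nsq z * nsq w.
Proof. by rewrite !nsqE ReM ImM; ring. Qed.

Lemma nsq_eq0 z : nsq z = 0 -> z = 0.
Proof.
rewrite nsqE => /eqP; rewrite paddr_eq0 ?sqr_ge0 // !sqrf_eq0.
by case: z => x y /= /andP[/eqP -> /eqP ->].
Qed.

Lemma nsqN z : nsq (- z) = nsq z.
Proof. by rewrite !nsqE ReN ImN; ring. Qed.

Lemma nsqD z w : nsq (z + w) <= 2 * nsq z + 2 * nsq w.
Proof. by rewrite !nsqE ReD ImD; have := sqr_ge0 (complex.Re z - complex.Re w);
  have := sqr_ge0 (complex.Im z - complex.Im w); nra. Qed.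

Lemma half_complex : (2 : C)^-1 = (2^-1 : R)%:C%C.
Proof. by rewrite fmorphV rmorph_nat. Qed.

End NormSquare.

(* An orthogonal basis is normalised to |e_b|^2 = 1/2, so that the trace vector
   of a two-point law is the sum of the basis vectors. *)
Section TwoDim.
Context {R : realType} (H : hilbert R).
Local Notation C := R[i].
Local Notation dot := (hs_dot H).

Definition coord (e : bool -> H) (b : bool) (v : H) : C := 2 * dot v (e b).

Definition half_basis (e : bool -> H) : Prop :=
  (forall b c, dot (e b) (e c) = if b == c then 2^-1 else 0) /\
  forall v, v = coord e true v *: e true + coord e false v *: e false.

Lemma half_basisI e :
  (forall b c, dot (e b) (e c) = if b == c then 2^-1 else 0) ->
  (forall w, (forall b, dot w (e b) = 0) -> w = 0) -> half_basis e.
Proof.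
move=> eE tot; split=> // v; apply/eqP; rewrite -subr_eq0; apply/eqP/tot => b.
rewrite hs_dotBl hs_dotDl !hs_dotZl !eE /coord.
by case: b => /=; field; rewrite ?pnatr_eq0.
Qed.

Definition diag_op (e : bool -> H) (a : bool -> C) (v : H) : H :=
  (a true * coord e true v) *: e true + (a false * coord e false v) *: e false.

Definition diag_ops (e : bool -> H) : set (H -> H) := range (diag_op e).

Variables (e : bool -> H).
Hypothesis he : half_basis e.
Local Notation c := (coord e).
Local Notation D := (diag_op e).

Lemma coordDZ b a (u v : H) : c b (a *: u + v) = a * c b u + c b v.
Proof. by rewrite /coord hs_dotDZl; ring. Qed.

Lemma coord0 b : c b 0 = 0.
Proof. by rewrite /coord linear0l mulr0. Qed.

Lemma coordD b (u v : H) : c b (u + v) = c b u + c b v.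
Proof. by rewrite -[u]scale1r coordDZ mul1r scale1r. Qed.

Lemma coordZ b a (u : H) : c b (a *: u) = a * c b u.
Proof. by rewrite -[a *: u]addr0 coordDZ coord0 addr0. Qed.

Lemma coordB b (u v : H) : c b (u - v) = c b u - c b v.
Proof. by rewrite coordD -scaleN1r coordZ mulN1r. Qed.

Lemma coord_basis b d : c b (e d) = (d == b)%:R.
Proof.
rewrite /coord (proj1 he); case: eqP => _; last by rewrite mulr0.
by rewrite mulfV // pnatr_eq0.
Qed.

Lemma coord_comb b x y : c b (x *: e true + y *: e false) = if b then x else y.
Proof.
by rewrite coordD !coordZ !coord_basis; case: b => /=; rewrite !mulr1n !mulr0n;
  ring.
Qed.

Lemma coord_ext u v : (forall b, c b u = c b v) -> u = v.
Proof. by move=> h; rewrite (proj2 he u) (proj2 he v) !h. Qed.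

Lemma dot_coord u v : dot u v = (c true u * (c true v)^* + c false u * (c false v)^*) / 2.
Proof.
rewrite {1}(proj2 he u) hs_dotDl !hs_dotZl.
rewrite !(hs_dotC (e _)) /coord !rmorphM /= rmorph_nat; field; rewrite ?pnatr_eq0 //.
Qed.

Lemma hnorm_sqr u : hnorm u ^+ 2 = (nsq (c true u) + nsq (c false u)) / 2.
Proof.
rewrite /hnorm sqr_sqrtr; last first.
  by have := hs_dot_ge0 u; rewrite lecE => /andP[].
by rewrite dot_coord !mulcJ_nsq half_complex -rmorphD -rmorphM.
Qed.

Lemma hnorm_ge0 (u : H) : 0 <= hnorm u. Proof. exact: sqrtr_ge0. Qed.

Lemma coord_diag b a v : c b (D a v) = a b * c b v.
Proof. by rewrite /D coord_comb; case: b. Qed.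

Lemma diag_opP a T : (forall b v, c b (T v) = a b * c b v) -> T = D a.
Proof. by move=> h; apply/funext => v; apply: coord_ext => b; rewrite h coord_diag. Qed.

Lemma diag_op_comb a s t :
  D a (s *: e true + t *: e false) = (a true * s) *: e true + (a false * t) *: e false.
Proof. by rewrite /diag_op !coord_comb. Qed.

Lemma diag_op_unique a T : linear T -> (forall b, T (e b) = a b *: e b) -> T = D a.
Proof.
move=> Tlin hT; apply/funext => v; rewrite {1}(proj2 he v).
have T0 : T 0 = 0 by have := Tlin (-1) 0 0; rewrite !scaleN1r !addNr.
have TZ s u : T (s *: u) = s *: T u by have := Tlin s u 0; rewrite T0 !addr0.
by rewrite Tlin TZ !hT !scalerA /diag_op; congr (_ *: _ + _ *: _); exact: mulrC.
Qed.

Lemma diag_inj a a' : D a = D a' -> a = a'.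
Proof.
move=> h; apply/funext => b; have := congr1 (fun T => c b (T (e b))) h.
by rewrite !coord_diag coord_basis eqxx !mulr1.
Qed.

Lemma hnorm_diag_le a K v : 0 <= K -> (forall b, nsq (a b) <= K ^+ 2) ->
  hnorm (D a v) <= K * hnorm v.
Proof.
move=> K0 ha; rewrite -ler_sqr ?nnegrE ?hnorm_ge0 ?mulr_ge0 ?hnorm_ge0 //.
rewrite exprMn !hnorm_sqr !coord_diag !(nsqM (a _)).
have := ha true; have := ha false.
have := nsq_ge0 (c true v); have := nsq_ge0 (c false v).
move: (nsq (c true v)) (nsq (c false v)) (nsq (a true)) (nsq (a false)) => p q r s; nra.
Qed.

Lemma bounded_diag a : bounded_op (D a).
Proof.
split=> [k u v|].
  apply: coord_ext => b.
  by rewrite coord_diag (coordDZ _ _ u) (coordDZ _ _ (D a u)) !coord_diag; ring.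
(* The summand 1 makes this bound K at least 1, hence nsq (a b) <= K <= K^2. *)
exists (nsq (a true) + nsq (a false) + 1) => v; apply: hnorm_diag_le => [|b].
  by rewrite !addr_ge0 ?nsq_ge0.
have := nsq_ge0 (a true); have := nsq_ge0 (a false); case: b; nra.
Qed.

Lemma adjoint_diag a : adjoint (D a) = D (fun b => (a b)^*).
Proof.
apply: adjoint_unique => u v; rewrite !dot_coord !coord_diag !rmorphM /= !conjCK.
by congr (_ / 2); ring.
Qed.

Lemma diag_lin k a a' : (fun v => k *: D a v + D a' v) = D (fun b => k * a b + a' b).
Proof. by apply: diag_opP => b v; rewrite coordDZ !coord_diag; ring. Qed.

Lemma diag_sub a a' : D a - D a' = D (fun b => a b - a' b).
Proof.
apply: diag_opP => b v; rewrite mulrBl -!coord_diag -coordB.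
by [].
Qed.

Lemma diag_comp a a' : D a \o D a' = D (fun b => a b * a' b).
Proof. by apply: diag_opP => b v /=; rewrite !coord_diag mulrA. Qed.

Lemma diag1 : idfun = D (fun=> 1).
Proof. by apply: diag_opP => b v /=; rewrite mul1r. Qed.

Lemma diag0 : (fun=> 0) = D (fun=> 0).
Proof. by apply: diag_opP => b v /=; rewrite mul0r coord0. Qed.

(** Testing on the two basis vectors suffices: off-diagonal entries of [T] vanish because those of
    every approximant do, and the diagonal of [T] is a limit of elements of [A]. *)
Lemma sot_closure_diag (A : set (bool -> C)) T : sot_closure (D @` A) T ->
  exists2 a, T = D a & forall d, 0 < d -> exists2 a', A a' & forall b, nsq (a b - a' b) <= d.
Proof.
move=> [[Tlin _] hT].
have hnear d : 0 < d -> exists2 a', A a' &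
    forall b b', nsq (c b (T (e b')) - a' b * (b' == b)%:R) <= d.
  move=> d0; have d2 : 0 < Num.min 1 (d / 2) by rewrite lt_min ltr01 divr_gt0.
  have [_ [a' Aa' <-] hv] := hT [:: e true; e false] _ d2.
  exists a' => // b b'; have /hv : e b' \in [:: e true; e false].
    by case: b'; rewrite !inE eqxx ?orbT.
  rewrite -coord_basis -coord_diag -coordB.
  set w := T _ - _ => hw.
  have h2 : hnorm w ^+ 2 <= d / 2.
    have m1 : Num.min 1 (d / 2) <= 1 by rewrite ge_min lexx.
    have m2 : Num.min 1 (d / 2) <= d / 2 by rewrite ge_min lexx orbT.
    have := hnorm_ge0 w; nra.
  move: h2; rewrite hnorm_sqr; have := nsq_ge0 (c true w); have := nsq_ge0 (c false w).
  by case: b; lra.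
have off b b' : b' != b -> c b (T (e b')) = 0.
  move=> /negbTE nb; apply: nsq_eq0; apply/eqP; rewrite eq_le nsq_ge0 andbT.
  apply/ler_addgt0Pr => d d0; rewrite add0r; have [a' _ /(_ b b')] := hnear d d0.
  by rewrite nb mulr0 subr0.
exists (fun b => c b (T (e b))).
  apply: diag_opP => b v; rewrite {1}(proj2 he v) Tlin coordDZ.
  have T0 : T 0 = 0 by have := Tlin (-1) 0 0; rewrite !scaleN1r !addNr.
  have -> s u : T (s *: u) = s *: T u by have := Tlin s u 0; rewrite T0 !addr0.
  by rewrite !coordZ; case: b; [rewrite (off true false)|rewrite (off false true)] => //; ring.
move=> d d0; have [a' Aa' h] := hnear d d0; exists a' => // b.
by have := h b b; rewrite eqxx mulr1.
Qed.

Lemma von_neumann_diag : von_neumann (diag_ops e).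
Proof.
split.
- by move=> _ [a _ <-]; exact: bounded_diag.
- by exists (fun=> 1) => //; rewrite diag1.
- by move=> k _ _ [a _ <-] [a' _ <-]; rewrite diag_lin; eexists.
- by move=> _ _ [a _ <-] [a' _ <-]; rewrite diag_comp; eexists.
- by move=> _ [a _ <-]; rewrite adjoint_diag; eexists.
- by move=> T /sot_closure_diag[a -> _]; exists a.
Qed.

Lemma sot_closure_diag_ops : sot_closure (diag_ops e) = diag_ops e.
Proof.
apply/seteqP; split; first exact: (vn_sot von_neumann_diag).
move=> T hT; split; first exact: (vn_bounded von_neumann_diag).
by move=> s r r0; exists T => // v _; rewrite subrr /hnorm linear0l /= sqrtr0.
Qed.

Definition scalar_ops : set (H -> H) := D @` [set a | a true = a false].

Lemma von_neumann_scalar : von_neumann scalar_ops.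
Proof.
split.
- by move=> _ [a _ <-]; exact: bounded_diag.
- by exists (fun=> 1) => //; rewrite diag1.
- move=> k _ _ [a /= ha <-] [a' /= ha' <-]; rewrite diag_lin.
  by eexists; [|reflexivity]; rewrite /= ha ha'.
- move=> _ _ [a /= ha <-] [a' /= ha' <-]; rewrite diag_comp.
  by eexists; [|reflexivity]; rewrite /= ha ha'.
- move=> _ [a /= ha <-]; rewrite adjoint_diag.
  by eexists; [|reflexivity]; rewrite /= ha.
- move=> T /sot_closure_diag[a -> h]; exists a => //=.
  apply/eqP; rewrite -subr_eq0; apply/eqP/nsq_eq0/eqP; rewrite eq_le nsq_ge0 andbT.
  apply/ler_addgt0Pr => d d0; rewrite add0r.
  have d4 : 0 < d / 4 by rewrite divr_gt0.
  have [a' /= ha' hd] := h _ d4.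
  have -> : a true - a false = (a true - a' true) + - (a false - a' false).
    by rewrite ha'; ring.
  apply: le_trans (nsqD _ _) _; rewrite nsqN.
  by have := hd true; have := hd false; lra.
Qed.

(** [scalar_ops] is a von Neumann algebra that contains [D a] but not the projection with entries 1
    and 0. *)
Lemma vn_generated_scalar a : a true = a false -> vn_generated (D a) <> diag_ops e.
Proof.
move=> ha /seteqP[_ /(_ (D (fun b => b%:R)))] h.
have /h /(_ scalar_ops von_neumann_scalar) : diag_ops e (D (fun b => b%:R)).
  by eexists.
have hs : scalar_ops (D a) by exists a.
move=> /(_ hs)[a' /= ha' /diag_inj ea]; move: ha'; rewrite ea /= => /eqP.
by rewrite oner_eq0.
Qed.

Definition sum_basis : H := e true + e false.
Definition vec_trace (w : H) (T : H -> H) : C := dot (T w) w.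
Local Notation tau := (vec_trace sum_basis).

Lemma trace_diag a : tau (D a) = (a true + a false) / 2.
Proof.
rewrite /vec_trace dot_coord !coord_diag /sum_basis !coordD !coord_basis /=.
by rewrite !(addr0, add0r) !mulr1 rmorph1 !mulr1.
Qed.

Lemma op_le_diag a a' : op_le (D a) (D a') <-> forall b, a b <= a' b.
Proof.
split=> [h b|h v].
  have := h (e b); rewrite dot_coord !coordB !coord_diag !coord_basis.
  rewrite pmulr_lge0 ?invr_gt0 ?ltr0n //.
  by case: b => /=; rewrite !(mulr1, mulr0, subr0, rmorph0, addr0, add0r, rmorph1) subr_ge0.
rewrite dot_coord !coordB !coord_diag -!mulrBl -(mulrA _ (c true v)) -(mulrA _ (c false v)) !mulcJ_nsq.
rewrite pmulr_lge0 ?invr_gt0 ?ltr0n //.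
by rewrite addr_ge0 // mulr_ge0 ?subr_ge0 ?h // ler0c nsq_ge0.
Qed.

(** The order is entrywise. The entrywise suprema form an upper bound, so the least one [s] lies
    below them; directedness then gives a single member close to [s] in both entries at once. *)
Lemma normal_diag : normal_on (diag_ops e) tau.
Proof.
move=> F S FM [T0 FT0] Fpos Fdir [s _ <-] hub hlub.
pose A := [set a | F (D a)].
have FA T : F T -> exists2 a, A a & T = D a.
  by move=> FT; have [a _ ea] := FM _ FT; exists a; rewrite /A /= ea.
have pos a b : A a -> 0 <= a b by move=> /Fpos; rewrite diag0 => /op_le_diag.
have lea a b : A a -> a b <= s b by move=> /hub /op_le_diag.
have [a0 Aa0 _] := FA _ FT0.
have imp a b : A a -> complex.Im (a b) = 0.
  by move=> /(pos a b); rewrite lecE => /andP[/eqP].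
have les a b : A a -> complex.Re (a b) <= complex.Re (s b).
  by move=> /(lea a b); rewrite lecE => /andP[].
pose X b := [set complex.Re (a b) | a in A].
have Xsup b : has_sup (X b).
  split; first by exists (complex.Re (a0 b)), a0.
  by exists (complex.Re (s b)) => _ [a Aa <-]; exact: les.
have sE b : complex.Re (s b) <= sup (X b).
  pose u b := (sup (X b))%:C%C : C.
  have : op_le (D s) (D u).
    apply: hlub; first by exists u.
    move=> _ /FA[a Aa ->]; apply/op_le_diag => d; rewrite /u lecE /= (imp _ _ Aa) eqxx.
    by apply: sup_upper_bound => //; exists a.
  by move=> /op_le_diag/(_ b); rewrite lecE => /andP[].
have RT a : complex.Re (tau (D a)) = (complex.Re (a true) + complex.Re (a false)) / 2.
  rewrite trace_diag half_complex.
  by rewrite ReM /= mulr0 subr0 ReD.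
apply/eqP; rewrite eq_le; apply/andP; split; last first.
  apply: ge_sup; first by exists (complex.Re (tau T0)), T0.
  by move=> _ [_ /FA[a Aa ->] <-]; rewrite !RT; have := les a true Aa; have := les a false Aa; lra.
apply/ler_addgt0Pr => d d0.
have hb b : exists2 a, A a & complex.Re (s b) - d < complex.Re (a b).
  have : complex.Re (s b) - d < sup (X b) by have := sE b; lra.
  by move=> /(sup_gt (proj1 (Xsup b)))[_ [a Aa <-] h]; exists a.
have [a1 Aa1 h1] := hb true; have [a2 Aa2 h2] := hb false.
have [_ [/FA[a3 Aa3 ->] /op_le_diag/(_ true) l1 /op_le_diag/(_ false) l2]] := Fdir _ _ Aa1 Aa2.
move: l1 l2; rewrite !lecE => /andP[_ l1] /andP[_ l2].
have : complex.Re (tau (D a3)) <= sup [set complex.Re (tau T) | T in F].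
  apply: sup_upper_bound; last by exists (D a3).
  split; first by exists (complex.Re (tau T0)), T0.
  exists (complex.Re (tau (D s))) => _ [_ /FA[a Aa ->] <-].
  by rewrite !RT; have := les a true Aa; have := les a false Aa; lra.
by rewrite !RT; lra.
Qed.

Lemma trace_sqr_diag a : tau (adjoint (D a) \o D a) = ((nsq (a true) + nsq (a false)) / 2)%:C%C.
Proof.
rewrite adjoint_diag diag_comp trace_diag.
by rewrite ![_^* * _]mulrC !mulcJ_nsq half_complex -rmorphD -rmorphM.
Qed.

Lemma tracial_diag : tracial_state (diag_ops e) tau.
Proof.
split.
- by move=> k _ _ [a _ <-] [a' _ <-]; rewrite diag_lin !trace_diag; field.
- by rewrite diag1 trace_diag; field.
- move=> _ [a _ <-]; rewrite trace_sqr_diag ler0c.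
  by rewrite divr_ge0 // addr_ge0 // nsq_ge0.
- by move=> _ _ [a _ <-] [a' _ <-]; rewrite !diag_comp !trace_diag; field.
- move=> _ [a _ <-]; rewrite trace_sqr_diag => -[/eqP].
  rewrite mulf_eq0 invr_eq0 pnatr_eq0 orbF paddr_eq0 ?nsq_ge0 // => /andP[/eqP h1 /eqP h2].
  by rewrite diag0; congr (D _); apply/funext => -[]; apply: nsq_eq0.
- exact: normal_diag.
Qed.

Lemma norm2_diag a : norm2 tau (D a) = Num.sqrt ((nsq (a true) + nsq (a false)) / 2).
Proof. by rewrite /norm2 trace_sqr_diag. Qed.

End TwoDim.

(** * Additivity of sums over supports, and the Hilbert seminorm of a trace *)

Section MalgSum.
Variables (K : choiceType) (G V : zmodType) (F : K -> G -> V).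
Hypothesis FB : forall k x y, F k (x - y) = F k x - F k y.

Let F0 k : F k 0 = 0.
Proof. by have := FB k 0 0; rewrite !subrr. Qed.

Lemma malg_sumEw (d : {fset K}) (g : malg K G) : (msupp g `<=` d)%fset ->
  \sum_(k <- msupp g) F k (mcoeff k g) = \sum_(k <- d) F k (mcoeff k g).
Proof.
by move=> le; rewrite [LHS](big_fset_incl _ le) => //= x xd /mcoeff_outdom ->.
Qed.

Lemma malg_sumB (g h : malg K G) :
  \sum_(k <- msupp (g - h)) F k (mcoeff k (g - h)) =
  \sum_(k <- msupp g) F k (mcoeff k g) - \sum_(k <- msupp h) F k (mcoeff k h).
Proof.
rewrite (@malg_sumEw (msupp g `|` msupp h)%fset) ?msuppB_le //.
rewrite (@malg_sumEw (msupp g `|` msupp h)%fset g) ?fsubsetUl //.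
rewrite (@malg_sumEw (msupp g `|` msupp h)%fset h) ?fsubsetUr //.
by rewrite -sumrB; apply: eq_bigr => k _; rewrite mcoeffB FB.
Qed.

End MalgSum.

Section TraceForm.
Context {R : realType} {H : hilbert R}.
Variables (M : set (H -> H)) (tau : (H -> H) -> R[i]).
Hypotheses (vM : von_neumann M) (tM : tracial_state M tau).
Local Notation C := R[i].
Local Notation dot := (hs_dot H).
Implicit Types S T : H -> H.

Lemma vn_zero : M (fun=> 0).
Proof.
have := vn_lin vM (-1) (vn_one vM) (vn_one vM).
by congr M; apply/funext => v /=; rewrite scaleN1r addNr.
Qed.

Lemma vn_add S T : M S -> M T -> M (S + T).
Proof.
move=> MS MT; have := vn_lin vM 1 MS MT.
by congr M; apply/funext => v; rewrite scale1r.
Qed.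

Lemma vn_scale a S : M S -> M (fun v => a *: S v).
Proof.
move=> MS; have := vn_lin vM a MS vn_zero.
by congr M; apply/funext => v; rewrite addr0.
Qed.

Lemma vn_opp S : M S -> M (- S).
Proof.
by move=> /(vn_scale (-1)); congr M; apply/funext => v; rewrite scaleN1r.
Qed.

Lemma vn_sub S T : M S -> M T -> M (S - T).
Proof. by move=> MS MT; apply: vn_add => //; exact: vn_opp. Qed.

Lemma vn_sum (J : Type) (r : seq J) (F : J -> H -> H) :
  (forall j, M (F j)) -> M (fun v => \sum_(j <- r) F j v).
Proof.
move=> MF; elim: r => [|j r IH].
  by have := vn_zero; congr M; apply/funext => v; rewrite big_nil.
by have := vn_add (MF j) IH; congr M; apply/funext => v; rewrite big_cons.
Qed.

Lemma trace0 : tau (fun=> 0) = 0.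
Proof.
have := ts_lin tM (-1) (vn_one vM) (vn_one vM); rewrite (ts_one tM) mulN1r addNr => <-.
by congr tau; apply/funext => v /=; rewrite scaleN1r addNr.
Qed.

(* An operator of M without adjoint would have the junk value 0 as adjoint, so
   that faithfulness would make it 0, which has an adjoint: no Riesz theorem. *)
Lemma adjointE T u v : M T -> dot (T u) v = dot u (adjoint T v).
Proof.
move=> MT; have [[S hS]|nS] := pselect (exists S, forall u v, dot (T u) v = dot u (S v)).
  by rewrite (adjoint_unique hS).
have a0 : adjoint T = fun=> 0.
  by apply: xgetPN => S hS; apply: nS; exists S.
have T0 : T = fun=> 0.
  apply: (ts_faithful tM) => //; rewrite a0 -[RHS]trace0; congr tau.
by rewrite a0 T0 linear0l linear0r.
Qed.

Lemma adjoint_lin a S T : M S -> M T ->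
  adjoint (fun v => a *: S v + T v) = fun v => a^* *: adjoint S v + adjoint T v.
Proof.
move=> MS MT; apply: adjoint_unique => u v.
by rewrite hs_dotDr hs_dotZr hs_dotDl hs_dotZl conjCK -!adjointE.
Qed.

Section Form.
Variables (V : lmodType C) (phi : V -> H -> H).
Hypotheses (Mphi : forall u, M (phi u)).
Hypothesis phiDZ : forall a u v, phi (a *: u + v) = fun w => a *: phi u w + phi v w.

(** A [semi_inner] needs a module, whereas [M] is only a set of operators; the form is therefore
    pulled back along a linear parametrisation [phi]. *)
Definition trace_form (u v : V) : C := tau (adjoint (phi v) \o phi u).

Lemma trace_formDZl a u v w :
  trace_form (a *: u + v) w = a * trace_form u w + trace_form v w.
Proof.
rewrite /trace_form phiDZ -(ts_lin tM); try by apply: (vn_comp vM) => //; apply: (vn_adj vM).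
congr tau; apply/funext => x /=.
by have [+ _] := vn_bounded vM (vn_adj vM (Mphi w)) => ->.
Qed.

Lemma trace_formDZr a u v w :
  trace_form w (a *: u + v) = a^* * trace_form w u + trace_form w v.
Proof.
rewrite /trace_form phiDZ adjoint_lin //.
by rewrite -(ts_lin tM) //; apply: (vn_comp vM) => //; apply: (vn_adj vM).
Qed.

Lemma trace_form_ge0 u : 0 <= trace_form u u.
Proof. exact: (ts_ge0 tM). Qed.

(** Symmetry is not an axiom of [tracial_state]. It follows by polarisation: positivity makes the
    form real at a u + v, for a = 1 and a = i. *)
Lemma trace_formC u v : trace_form u v = (trace_form v u)^*.
Proof.
have Im0 w : complex.Im (trace_form w w) = 0.
  by have := trace_form_ge0 w; rewrite lecE => /andP[/eqP ->].
have h a : complex.Im (a * trace_form u v + a^* * trace_form v u) = 0.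
  have := Im0 (a *: u + v); rewrite trace_formDZl !trace_formDZr.
  move: (Im0 u) (Im0 v); case: (trace_form u u) (trace_form v v) => [x ?] [y ?] /= -> ->.
  by case: (trace_form u v) (trace_form v u) a => [b c] [d e] [f g] /= h; lra.
have h1 := h 1; have hi := h 'i%C; move: h1 hi.
case: (trace_form u v) (trace_form v u) => [a b] [c d] /= h1 h2.
by congr Complex; lra.
Qed.

Definition trace_sip : semi_inner V :=
  SemiInner trace_formDZl trace_formC trace_form_ge0.

Lemma norm2_sip u : norm2 tau (phi u) = sinorm trace_sip u.
Proof. by []. Qed.

End Form.

(** Minkowski's inequality on C^2, with the form pulled back along (a, b) |-> a S + b T. *)
Lemma norm2D S T : M S -> M T -> norm2 tau (S + T) <= norm2 tau S + norm2 tau T.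
Proof.
move=> MS MT; pose phi (u : C^o * C^o) := fun v => u.1 *: S v + u.2 *: T v.
have Mphi u : M (phi u) by apply: (vn_lin vM) => //; exact: vn_scale.
have phiDZ a u v : phi (a *: u + v) = fun w => a *: phi u w + phi v w.
  by apply/funext => w; rewrite /phi /= !scalerDl scalerDr !scalerA addrACA.
have -> : S + T = phi ((1, 0) + (0, 1)).
  by apply/funext => v; rewrite /phi /= addr0 add0r !scale1r.
have {1}-> : S = phi (1, 0).
  by apply/funext => v; rewrite /phi /= scale0r addr0 scale1r.
have {1}-> : T = phi (0, 1).
  by apply/funext => v; rewrite /phi /= scale0r add0r scale1r.
rewrite !(norm2_sip Mphi phiDZ); exact: sinormD.
Qed.

Lemma norm2N T : M T -> norm2 tau (- T) = norm2 tau T.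
Proof.
move=> MT; rewrite /norm2; congr (Num.sqrt (complex.Re (tau _))).
have e : adjoint (- T) = - adjoint T.
  apply: adjoint_unique => u v; rewrite linearNl linearNr; congr (- _).
  exact: adjointE.
have [lin _] := vn_bounded vM (vn_adj vM MT).
rewrite e; apply/funext => v /=.
have -> : (- adjoint T) ((- T) v) = - adjoint T (- T v) by [].
have := lin (-1) (T v) 0; rewrite addr0 scaleN1r => ->.
rewrite scaleN1r opprD opprK.
have := lin (-1) 0 0; rewrite scaler0 addr0 scaleN1r addNr => ->.
by rewrite subr0.
Qed.

Lemma norm2B S T : M S -> M T -> norm2 tau (S - T) = norm2 tau (T - S).
Proof. by move=> MS MT; rewrite -norm2N ?opprB //; exact: vn_sub. Qed.

Lemma norm2_tri U S T : M S -> M T -> M U ->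
  norm2 tau (S - T) <= norm2 tau (S - U) + norm2 tau (U - T).
Proof.
move=> MS MT MU; rewrite -[S - T](subrKA U).
by apply: norm2D; exact: vn_sub.
Qed.

End TraceForm.

(* The limit exists, possibly as an infinite value. *)
Lemma limn_lt_eventually {R : realType} (a : nat -> \bar R) (e : R) :
  (forall d : R, 0 < d -> exists n0, forall n m, (n0 <= n)%N -> (n0 <= m)%N ->
    (a n <= a m + d%:E)%E) ->
  (limn a < e%:E)%E -> exists n0, forall n, (n0 <= n)%N -> (a n < e%:E)%E.
Proof.
move=> hc ha.
have [n1 h1] := hc 1 ltr01.
have [an1|an1|an1] : [\/ a n1 = +oo%E, a n1 = -oo%E | exists r, a n1 = r%:E].
  by case: (a n1) => [r| |]; [apply: Or33; exists r|apply: Or31|apply: Or32].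
- have acvg : a n @[n --> \oo] --> +oo%E.
    apply: cvg_near_cst; exists n1 => // n /= nn1.
    by have := h1 n1 n (leqnn _) nn1; rewrite an1; case: (a n).
  by move: ha; rewrite (cvg_lim _ acvg).
- exists n1 => n nn1; have := h1 n n1 nn1 (leqnn _); rewrite an1 /= leeNy_eq => /eqP.
  by move=> ->; rewrite ltNyr.
have [r1 ar1] := an1.
have fin n : (n1 <= n)%N -> a n = (fine (a n))%:E.
  move=> nn1; have := h1 n n1 nn1 (leqnn _); have := h1 n1 n (leqnn _) nn1.
  by rewrite ar1; case: (a n).
have fc : cvgn (fine \o a).
  apply: R_complete; apply: (@cauchy_exP R R) => d d0.
  have d2 : 0 < d / 2 by rewrite divr_gt0.
  have [n2 h2] := hc _ d2; exists (fine (a (maxn n1 n2))), (maxn n1 n2) => // k /=.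
  rewrite geq_max => /andP[k1 k2].
  have := h2 (maxn n1 n2) k (leq_maxr _ _) k2.
  have := h2 k (maxn n1 n2) k2 (leq_maxr _ _).
  rewrite (fin k k1) (fin (maxn n1 n2) (leq_maxl _ _)) !lee_fin /= => p q.
  by rewrite /ball /= ltr_norml; apply/andP; split; lra.
have acvg : a n @[n --> \oo] --> (limn (fine \o a))%:E.
  by apply/fine_cvgP; split=> //; exists n1 => // n /= /fin ->.
move: ha; rewrite (cvg_lim _ acvg) // lte_fin => lt_e.
have [n2 _ h2] := cvgr_lt _ fc _ lt_e.
exists (maxn n1 n2) => n; rewrite geq_max => /andP[k1 k2].
by rewrite (fin n k1) lte_fin; exact: h2.
Qed.

(** * The uniform seminorm and representatives in its completion *)

Section NormR2.
Context {R : realType} {I : choiceType} (rad : I -> R).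
Local Notation N := (normR2 (rad := rad)).
Implicit Types f g h : AR rad.

Lemma AR_opB (H : hilbert R) (tau : (H -> H) -> R[i]) x f g :
  AR_op tau x (f - g) = AR_op tau x f - AR_op tau x g.
Proof.
apply/funext => v; rewrite /AR_op.
pose F w (phi : csigma rad) :=
  'valL_(0 : R[i]^o) (phi : Sigma rad -> R[i]^o) (law_of tau x) *: word_op x w v.
apply: (malg_sumB (F := F)) => w phi psi; rewrite /F /= -scalerBl; congr (_ *: _).
(* Off [Sigma rad] both sides take the default value 0. *)
by case: 'oinv_set_val => [l|] //=; rewrite subr0.
Qed.

Lemma word_op_in (H : hilbert R) (M : set (H -> H)) (x : I -> H -> H) w : von_neumann M ->
  (forall i, M (x i)) -> M (word_op x w).
Proof.
move=> vM Mx; elim: w => [|[i b] w IH] /=; first exact: (vn_one vM).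
by apply: (vn_comp vM) => //; case: b => //=; apply: (vn_adj vM).
Qed.

Lemma AR_op_in (H : hilbert R) (M : set (H -> H)) tau (x : I -> H -> H) f : von_neumann M ->
  (forall i, M (x i)) -> M (AR_op tau x f).
Proof.
move=> vM Mx; apply: vn_sum => // w; apply: vn_scale => //.
exact: word_op_in.
Qed.

Lemma normR2_ub (M : tracial_vna R) (x : I -> tv_space M -> tv_space M) f :
  (forall i, op_ball (tv_alg M) (rad i) (x i)) ->
  ((norm2 (tv_trace M) (AR_op (tv_trace M) x f))%:E <= N f)%E.
Proof. by move=> hx; apply: ereal_sup_ubound; exists M, x. Qed.

Lemma normR2_tri g f h : (N (f - h)%R <= N (f - g)%R + N (g - h)%R)%E.
Proof.
apply: ge_ereal_sup => _ [M [x [hx ->]]].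
have Mx i : tv_alg M (x i) by case: (hx i).
have := normR2_ub (f - g) hx; have := normR2_ub (g - h) hx => h1 h2.
apply: le_trans (leeD h2 h1); rewrite -EFinD lee_fin !AR_opB.
by apply: (norm2_tri (tv_vn M) (tv_state M)); apply: AR_op_in => //; exact: tv_vn.
Qed.

Lemma reprc_cauchy (F : FR2 rad) : cauchy_in [set: AR rad] N (reprc (val F)).
Proof.
have [u hu uF] := set_mem (valP F).
have : val F (reprc (val F)); last by rewrite -[X in X (reprc _)]uF => -[].
apply: xgetPex; exists u; rewrite -[X in X u]uF; split=> // e e0.
have [n0 hn] := hu.2 e e0; exists n0 => n nn0.
(* The seminorm of 0 is bounded by the Cauchy condition at equal indices, rather than computed. *)
by rewrite subrr -(subrr (u n)); exact: hn.
Qed.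

(** Turns the hypothesis of continuity, stated with a limit of extended reals, into strict bounds on
    representatives. *)
Lemma cdist_lt (F G : FR2 rad) (e : R) : (FR2_dist F G < e%:E)%E ->
  exists n0, forall n, (n0 <= n)%N -> (N (reprc (val F) n - reprc (val G) n)%R < e%:E)%E.
Proof.
rewrite /FR2_dist /cdist; set u := reprc (val F); set v := reprc (val G).
apply: limn_lt_eventually => d d0; have d2 : 0 < d / 2 by rewrite divr_gt0.
have [n1 h1] := (reprc_cauchy F).2 _ d2; have [n2 h2] := (reprc_cauchy G).2 _ d2.
exists (maxn n1 n2) => n m; rewrite !geq_max => /andP[p1 p2] /andP[q1 q2].
apply: le_trans (normR2_tri (u m) _ _) _.
apply: le_trans (leeD (lexx _) (normR2_tri (v m) _ _)) _.
have t1 := ltW (h1 _ _ p1 q1); have t2 := ltW (h2 _ _ q2 p2).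
apply: le_trans (leeD t1 (leeD (lexx _) t2)) _.
by rewrite addeCA -EFinD -splitr.
Qed.

End NormR2.

(** * Density in the completion, and evaluation at scalar points *)

Section Density.
Context {R : realType} (V : lmodType R[i]) (p : semi_inner V).
Local Notation emb := (hembed p).

Lemma hembedDZ a u v : emb (a *: u + v) = a *: emb u + emb v.
Proof.
have -> : a *: emb u + emb v = hadd (hscale a (emb u)) (emb v) by [].
by rewrite hscaleE haddE; exact: hclass_ext.
Qed.

Lemma hembed0 : emb 0 = 0.
Proof.
have := hembedDZ 1 0 0; rewrite !scale1r addr0 => /eqP.
by rewrite eq_sym -subr_eq0 addrK => /eqP.
Qed.

Lemma hembedZ a u : emb (a *: u) = a *: emb u.
Proof. by have := hembedDZ a u 0; rewrite hembed0 !addr0. Qed.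

Lemma hembedD u v : emb (u + v) = emb u + emb v.
Proof. by have := hembedDZ 1 u v; rewrite !scale1r. Qed.

Lemma hdot_hembed u v : hdot (emb u) (emb v) = p u v.
Proof. by apply: hdot_unique; exact: cvg_cst. Qed.

Lemma hembed_total (c : hcompletion_hilbert p) :
  (forall v, hs_dot (hcompletion_hilbert p) c (emb v) = 0) -> c = 0.
Proof.
move=> h; apply: (@hs_dense_orthogonal _ _ c (range emb)) => [e e0|_ [v _ <-] //].
have [n hn] := hrepP (c : hcompletion p) e0; exists (emb (hrep (c : hcompletion p) n)) => //.
have {1}-> : c = hclass (hrepP (c : hcompletion p)) by rewrite hrepK.
suff : sinorm (hsip p) (hclass (hrepP (c : hcompletion p)) - emb (hrep (c : hcompletion p) n)) <= e by [].
rewrite hclassB; apply: (@sinorm_hclass_le _ _ _ _ _ _ n) => [|m hm].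
  exact: ltW.
by apply/ltW/hn.
Qed.

End Density.

Section WordValue.
Context {R : realType} {I : choiceType}.
Local Notation C := R[i].

Definition word_val (y : I -> C) (w : word I) : C :=
  \prod_(a <- w) (if a.2 then (y a.1)^* else y a.1).

Lemma word_val_morph y : mmorphism (word_val y).
Proof. by split=> [u v|]; rewrite /word_val ?big_cat //= big_nil. Qed.

HB.instance Definition _ y :=
  monalg.isMultiplicative.Build (word I) C (word_val y) (word_val_morph y).

End WordValue.

(* Locked: unification would otherwise unfold the products of polynomials. *)
HB.lock Definition nceval (R : realType) (I : choiceType) (y : I -> R[i])
  (P : ncpoly R I) : R[i] := mmap idfun (word_val y) P.

Section PointEvaluation.
Context {R : realType} {I : choiceType}.
Local Notation C := R[i].
Implicit Types (y : I -> C) (P Q : ncpoly R I) (w : word I).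

Lemma ncevalE y P : nceval y P = \sum_(w <- msupp P) mcoeff w P * word_val y w.
Proof. by rewrite nceval.unlock. Qed.

Lemma ncevalD y P Q : nceval y (P + Q) = nceval y P + nceval y Q.
Proof. by rewrite nceval.unlock mmapD. Qed.

Lemma ncevalB y P Q : nceval y (P - Q) = nceval y P - nceval y Q.
Proof. by rewrite nceval.unlock mmapB. Qed.

Lemma ncevalZ y a P : nceval y (a *: P) = a * nceval y P.
Proof. by rewrite nceval.unlock mmapZ. Qed.

Lemma nceval_lin2 y a b P Q :
  nceval y (a *: P + b *: Q) = a * nceval y P + b * nceval y Q.
Proof. exact: etrans (ncevalD _ _ _) (congr2 +%R (ncevalZ _ _ _) (ncevalZ _ _ _)). Qed.

Lemma ncevalM y P Q : nceval y (P * Q) = nceval y P * nceval y Q.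
Proof. by rewrite nceval.unlock rmorphM. Qed.

Lemma nceval1 y : nceval y 1 = 1.
Proof. by rewrite nceval.unlock rmorph1. Qed.

Lemma ncevalX y P n : nceval y (P ^+ n) = nceval y P ^+ n.
Proof. by rewrite nceval.unlock rmorphXn. Qed.

Lemma nceval_var y i : nceval y (ncvar i) = y i.
Proof. by rewrite nceval.unlock /ncvar mmapU /word_val big_seq1 mul1r. Qed.

Lemma nceval_star y P : nceval y (ncstar P) = (nceval y P)^*.
Proof.
rewrite nceval.unlock /ncstar raddf_sum /= mmapE rmorph_sum; apply: eq_bigr => w _.
rewrite mmapU rmorphM; congr (_ * _).
(* Reversing the word does not matter, as [C] is commutative. *)
rewrite /word_val /star_word (perm_big [seq (a.1, ~~ a.2) | a <- w]) ?perm_rev //=.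
rewrite big_map rmorph_prod; apply: eq_bigr => -[i []] _ //=.
by rewrite conjCK.
Qed.

End PointEvaluation.

Section AREvaluation.
Context {R : realType} {I : choiceType} (rad : I -> R).
Local Notation C := R[i].

(** [l] and [y] are separate arguments: in use [y] is one of the two points carrying [l], and [l]
    alone does not tell which. *)
Definition AR_val (l : Sigma rad) (y : I -> C) (g : AR rad) : C :=
  \sum_(w <- msupp g) (mcoeff w g : Sigma rad -> R[i]^o) l * word_val y w.

Lemma AR_valB l y g h : AR_val l y (g - h) = AR_val l y g - AR_val l y h.
Proof.
pose F w (phi : csigma rad) := (phi : Sigma rad -> R[i]^o) l * word_val y w : C.
by apply: (malg_sumB (F := F)) => w phi psi; rewrite /F /= -mulrBl.
Qed.

End AREvaluation.

(* Lagrange interpolation at the two points in the separating variable T_k. *)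
HB.lock Definition interp (R : realType) (I : choiceType) (x : bool -> I -> R[i])
    (k : I) (b : bool) : ncpoly R I :=
  (x b k - x (~~ b) k)^-1 *: (ncvar k - x (~~ b) k *: 1).

(** * The GNS representation of a two-point law *)

Section TwoPointLaw.
Context {R : realType} {I : choiceType} (rad : I -> R).
Local Notation C := R[i].
Variable x : bool -> I -> C.
Hypothesis rad_ge0 : forall i, 0 <= rad i.
Hypothesis xrad : forall b i, nsq (x b i) <= rad i ^+ 2.

Definition two_point : {ptws ncpoly R I -> R[i]^o} :=
  fun P => (nceval (x true) P + nceval (x false) P) / 2.

Lemma two_point_sqr P Q : two_point (ncstar Q * P) =
  (nceval (x true) P * (nceval (x true) Q)^* + nceval (x false) P * (nceval (x false) Q)^*) / 2.
Proof. by rewrite /two_point !ncevalM !nceval_star ![_^* * _]mulrC. Qed.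

(* Rewriting would have to compare the products P * Q and Q * P by conversion,
   which is slow. *)
Lemma two_pointC P Q : two_point (P * Q) = two_point (Q * P).
Proof.
have h y : nceval y (P * Q) = nceval y (Q * P).
  exact: etrans (ncevalM y P Q) (etrans (mulrC _ _) (esym (ncevalM y Q P))).
exact: (congr2 (fun a b => (a + b) / 2) (h (x true)) (h (x false))).
Qed.

Lemma two_point_in : Sigma rad two_point.
Proof.
split.
- by move=> a P Q; rewrite /two_point !ncevalD !ncevalZ; field.
- by rewrite /two_point !nceval1; field.
- exact: two_pointC.
- move=> P; rewrite two_point_sqr !mulcJ_nsq half_complex -rmorphD -rmorphM ler0c.
  by rewrite divr_ge0 // addr_ge0 // nsq_ge0.
- move=> i k; rewrite /two_point !ncevalX !ncevalM !nceval_star !nceval_var.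
  rewrite ![_^* * _]mulrC !mulcJ_nsq half_complex -!rmorphXn -rmorphD -rmorphM lecR exprM.
  have h b : nsq (x b i) ^+ k <= (rad i ^+ 2) ^+ k.
    by rewrite lerXn2r ?nnegrE ?nsq_ge0 ?sqr_ge0.
  by have := h true; have := h false; lra.
Qed.

Definition two_point_law : Sigma rad := exist _ two_point (mem_set two_point_in).
Local Notation l := two_point_law.
Local Notation cls := (L2cls l).
Local Notation Ldot := (hs_dot (L2law l)).

Lemma L2clsD P Q : cls (P + Q) = cls P + cls Q.
Proof. exact: hembedD. Qed.

Lemma L2clsZ a P : cls (a *: P) = a *: cls P.
Proof. exact: hembedZ. Qed.

Lemma L2cls_dot P Q : Ldot (cls P) (cls Q) =
  (nceval (x true) P * (nceval (x true) Q)^* + nceval (x false) P * (nceval (x false) Q)^*) / 2.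
Proof. by rewrite -two_point_sqr; exact: hdot_hembed. Qed.

(** Inner products with classes of polynomials see only the values at the two points, and these
    classes are dense. *)
Lemma L2cls_eq P Q : (forall b, nceval (x b) P = nceval (x b) Q) -> cls P = cls Q.
Proof.
move=> h; apply/eqP; rewrite -subr_eq0; apply/eqP; apply: hembed_total => S.
have : Ldot (cls P - cls Q) (cls S) = 0; last by [].
by rewrite hs_dotBl !L2cls_dot !h subrr.
Qed.

Variable k : I.
Hypothesis xk : x true k != x false k.

Local Notation interp := (interp x k).

Lemma nceval_interp b d : nceval (x d) (interp b) = (d == b)%:R.
Proof.
have xb : x b k - x (~~ b) k != 0 by rewrite subr_eq0; case: b => //; rewrite eq_sym.
rewrite interp.unlock ncevalZ ncevalB ncevalZ nceval1 mulr1 !nceval_var.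
have [->|/negbTE db] := eqVneq d b.
  by rewrite -[RHS](mulVf xb); ring.
have -> : d = ~~ b by case: (d) (b) db => [] [].
by rewrite subrr mulr0.
Qed.

Lemma nceval_comb a b :
  nceval (x b) (a true *: interp true + a false *: interp false) = a b.
Proof.
rewrite nceval_lin2 !nceval_interp.
by case: b; rewrite /= mulr1 mulr0 (addr0, add0r).
Qed.

Definition L2basis b : L2law l := cls (interp b).
Local Notation e := L2basis.

Lemma L2cls_basis P :
  cls P = nceval (x true) P *: e true + nceval (x false) P *: e false.
Proof.
rewrite -!L2clsZ -L2clsD; apply: L2cls_eq => b.
by rewrite (nceval_comb (fun b => nceval (x b) P)).
Qed.

Lemma L2basis_half : half_basis e.
Proof.
apply: half_basisI => [b c|w hw].
  rewrite L2cls_dot !nceval_interp.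
  by case: b; case: c => /=; rewrite ?rmorph1 ?rmorph0; ring.
apply: hembed_total => P; have : Ldot w (cls P) = 0; last by [].
by rewrite L2cls_basis hs_dot_lin2r !hw !mulr0 addr0.
Qed.

Let he := L2basis_half.

(** The diagonal operator meets the specification chosen by [xget]. Any other candidate agrees with
    it on the basis, because [P * interp b] and [P(x_b) interp b] coincide at both points. *)
Lemma gns_diag P : gns (l := l) P = diag_op e (fun b => nceval (x b) P).
Proof.
apply: xget_unique => [|T [[Tlin _] hT]].
  split=> [|Q]; first exact: (bounded_diag he).
  rewrite [in LHS]L2cls_basis [RHS]L2cls_basis (diag_op_comb he).
  exact: (congr2 (fun a b => a *: e true + b *: e false) (esym (ncevalM _ _ _))
    (esym (ncevalM _ _ _))).
apply: (diag_op_unique he) => // b.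
rewrite (hT (interp b)) -L2clsZ; apply: L2cls_eq => d.
by rewrite ncevalM ncevalZ nceval_interp; case: eqP => [->|_]; rewrite ?mulr0.
Qed.

(** Interpolation realises every diagonal by a polynomial, so the range of [gns] is already
    closed. *)
Lemma law_vna_diag : law_vna l = diag_ops e.
Proof.
have rg : range (gns (l := l)) = diag_ops e.
  apply/seteqP; split=> _ [a _ <-]; first by rewrite gns_diag; eexists.
  exists (a true *: interp true + a false *: interp false) => //.
  rewrite gns_diag; congr (diag_op e); apply/funext => b; exact: nceval_comb.
rewrite /law_vna rg; exact: sot_closure_diag_ops.
Qed.

Lemma law_trace_diag : law_trace l = vec_trace (sum_basis e).
Proof.
apply/funext => T; rewrite /law_trace /vec_trace.
have -> // : cls 1 = sum_basis e.
by rewrite L2cls_basis !nceval1 !scale1r.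
Qed.

Lemma two_point_vn : von_neumann (law_vna l).
Proof. by rewrite law_vna_diag; exact: von_neumann_diag. Qed.

Lemma two_point_tracial : tracial_state (law_vna l) (law_trace l).
Proof. by rewrite law_vna_diag law_trace_diag; exact: tracial_diag. Qed.

Definition two_point_vna : tracial_vna R := TracialVNA two_point_vn two_point_tracial.

Lemma gns_var_ball i : op_ball (law_vna l) (rad i) (gns_var l i).
Proof.
rewrite law_vna_diag /gns_var gns_diag; split=> [|v]; first by eexists.
by apply: (hnorm_diag_le he) => // b; rewrite nceval_var.
Qed.

Lemma word_op_diag w : word_op (gns_var l) w = diag_op e (fun b => word_val (x b) w).
Proof.
elim: w => [|[i c] w IH] /=.
  by rewrite (diag1 he); congr (diag_op e _); apply/funext => b; rewrite /word_val big_nil.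
rewrite IH /gns_var gns_diag; case: c; rewrite ?(adjoint_diag he) (diag_comp he);
  by congr (diag_op e _); apply/funext => b; rewrite nceval_var /word_val big_cons.
Qed.

Lemma sum_diag (J : Type) (r : seq J) (c : J -> C) (a : J -> bool -> C) v :
  \sum_(j <- r) c j *: diag_op e (a j) v = diag_op e (fun b => \sum_(j <- r) c j * a j b) v.
Proof.
apply: (coord_ext he) => b; rewrite (coord_diag he) mulr_suml.
elim: r => [|j r IH]; first by rewrite !big_nil coord0.
by rewrite !big_cons coordDZ (coord_diag he) IH mulrA.
Qed.

(** The identity l_theta = l; through it the coefficients in C(Sigma_R) enter [AR_op] with their
    value at [l] itself. *)
Lemma law_of_gns : law_of (law_trace l) (gns_var l) = two_point.
Proof.
apply/funext => P; rewrite /law_of law_trace_diag.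
have -> : ncpoly_op (gns_var l) P = diag_op e (fun b => nceval (x b) P).
  apply/funext => v; rewrite /ncpoly_op.
  under eq_bigr do rewrite word_op_diag.
  rewrite sum_diag; congr (diag_op e _ v); apply/funext => b.
  by rewrite ncevalE.
by rewrite (trace_diag he).
Qed.

Lemma AR_op_diag (g : AR rad) :
  AR_op (law_trace l) (gns_var l) g = diag_op e (fun b => AR_val l (x b) g).
Proof.
apply/funext => v; rewrite /AR_op law_of_gns.
under eq_bigr do rewrite word_op_diag.
rewrite sum_diag; congr (diag_op e _ v); apply/funext => b.
apply: eq_bigr => w _; congr (_ * _).
have F := congr1 (fun F => F (mcoeff w g : Sigma rad -> R[i]^o))
  (@sigL_valL _ _ (0 : R[i]^o) (Sigma rad)).
by rewrite -[in RHS]F.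
Qed.

(** Each entry contributes half its squared modulus to the squared 2-norm, hence the factor 2. *)
Lemma AR_val_le (g : AR rad) (d : R) b : (normR2 g < d%:E)%E ->
  nsq (AR_val l (x b) g) <= 2 * d ^+ 2.
Proof.
move=> gd; have := normR2_ub (M := two_point_vna) g gns_var_ball.
move=> /le_lt_trans /(_ gd) /=; rewrite lte_fin AR_op_diag law_trace_diag.
rewrite (norm2_diag he).
set s := _ / 2 => sd; have s0 : 0 <= s by rewrite divr_ge0 // addr_ge0 // nsq_ge0.
have d0 : 0 < d by apply: le_lt_trans sd; exact: sqrtr_ge0.
have : s < d ^+ 2 by rewrite -(sqr_sqrtr s0) ltr_sqr ?nnegrE ?sqrtr_ge0 // ltW.
have := nsq_ge0 (AR_val l (x true) g); have := nsq_ge0 (AR_val l (x false) g).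
by rewrite /s; case: b; lra.
Qed.

End TwoPointLaw.

(** * Continuity of two-point laws and of polynomial values *)

Section ComplexContinuity.
Context {R : realType}.
Local Notation C := R[i].

Lemma normc_ge_Im (z : C) : `|complex.Im z|%:C%C <= `|z|.
Proof.
by have := normc_ge_Re (z * 'i%C); rewrite ReiNIm normrN normrM normCi mulr1.
Qed.

Lemma Re_continuous : continuous (@complex.Re R : C^o -> R).
Proof.
move=> z; apply/(@cvgrPdist_lt _ _ _ (nbhs (z : C^o)) (nbhs_filter _)) => e e0.
have e0' : 0 < e%:C%C :> C by rewrite ltcR.
near=> w; have : ball (z : C^o) e%:C%C w by near: w; exact: nbhsx_ballx.
rewrite /ball /= -ltcR; apply: le_lt_trans.
by rewrite -ReN -ReD; exact: normc_ge_Re.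
Unshelve. all: by end_near.
Qed.

Lemma Im_continuous : continuous (@complex.Im R : C^o -> R).
Proof.
move=> z; apply/(@cvgrPdist_lt _ _ _ (nbhs (z : C^o)) (nbhs_filter _)) => e e0.
have e0' : 0 < e%:C%C :> C by rewrite ltcR.
near=> w; have : ball (z : C^o) e%:C%C w by near: w; exact: nbhsx_ballx.
rewrite /ball /= -ltcR; apply: le_lt_trans.
by rewrite -ImN -ImD; exact: normc_ge_Im.
Unshelve. all: by end_near.
Qed.

Lemma real_complex_continuous : continuous (real_complex R : R -> C^o).
Proof.
move=> x; apply/(@cvgrPdist_lt _ _ _ (nbhs (x : R)) (nbhs_filter _)) => e e0.
(* Radii of balls in [C^o] are complex numbers; a positive one is real. *)
have e1 : complex.Im e = 0 by apply: ger0_Im; exact: ltW.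
have ee : e = (complex.Re e)%:C%C by case: (e) e1 => a b /= ->.
have e0' : 0 < complex.Re e by rewrite -ltcR -ee.
near=> w; have : ball x (complex.Re e) w by near: w; exact: nbhsx_ballx.
rewrite /ball /= => h; rewrite ee -rmorphB normc_def /= expr0n addr0 sqrtr_sqr.
by rewrite ltcR.
Unshelve. all: by end_near.
Qed.

Lemma conj_continuous : continuous (@Num.conj C : C^o -> C^o).
Proof.
move=> z; apply/(@cvgrPdist_lt _ _ _ (nbhs (z : C^o)) (nbhs_filter _)) => e e0.
near=> w; have : ball (z : C^o) e w by near: w; exact: nbhsx_ballx.
by rewrite /ball /= -rmorphB norm_conjC.
Unshelve. all: by end_near.
Qed.

Lemma continuous_Complex (T : topologicalType) (f g : T -> R) :
  continuous f -> continuous g -> continuous (fun t => Complex (f t) (g t) : C^o).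
Proof.
move=> fc gc t.
have -> : (fun t => Complex (f t) (g t) : C^o) =
    (fun t => (f t)%:C%C + (g t)%:C%C * 'i%C : C^o).
  by apply/funext => s; congr Complex; rewrite /= ?mulr0 ?mulr1 ?subr0 ?addr0 ?mul0r ?add0r ?addr0.
apply: cvgD; first by apply: continuous_comp; [exact: fc|exact: real_complex_continuous].
apply: cvgM; last exact: cvg_cst.
by apply: continuous_comp; [exact: gc|exact: real_complex_continuous].
Qed.

Lemma continuous_sum (T : topologicalType) (J : Type) (r : seq J) (F : J -> T -> C^o) :
  (forall j, continuous (F j)) -> continuous (fun t => \sum_(j <- r) F j t : C^o).
Proof.
move=> Fc; elim: r => [|j r IH].
  rewrite (_ : (fun t => _) = fun=> 0); first exact: cst_continuous.
  by apply/funext => t; rewrite big_nil.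
rewrite (_ : (fun t => _) = fun t => F j t + \sum_(j <- r) F j t).
  by move=> t; apply: cvgD; [exact: Fc|exact: IH].
by apply/funext => t; rewrite big_cons.
Qed.

Lemma word_val_continuous (T : topologicalType) (I : choiceType) (y : T -> I -> C) w :
  (forall i, continuous (y^~ i : T -> C^o)) ->
  continuous (fun t => word_val (y t) w : C^o).
Proof.
move=> yc; elim: w => [|[i b] w IH].
  rewrite (_ : (fun t => _) = fun=> 1); first exact: cst_continuous.
  by apply/funext => t; rewrite /word_val big_nil.
rewrite (_ : (fun t => _) = fun t => (if b then (y t i)^* else y t i) * word_val (y t) w).
  move=> t; apply: cvgM; last exact: IH.
  by case: b; [apply: continuous_comp (@conj_continuous _)|]; exact: yc.
by apply/funext => t; rewrite /word_val big_cons.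
Qed.

Lemma nceval_continuous (T : topologicalType) (I : choiceType) (y : T -> I -> C) P :
  (forall i, continuous (y^~ i : T -> C^o)) ->
  continuous (fun t => nceval (y t) P : C^o).
Proof.
move=> yc; under eq_fun do rewrite ncevalE; apply: continuous_sum => w t.
by apply: cvgM; [exact: cvg_cst|exact: word_val_continuous].
Qed.

End ComplexContinuity.

Section TwoPointContinuity.
Context {R : realType} {I : choiceType} (rad : I -> R) (T : topologicalType).
Local Notation C := R[i].
Variable x : T -> bool -> I -> C.
Hypothesis xrad : forall t b i, nsq (x t b i) <= rad i ^+ 2.
Hypothesis xc : forall b i, continuous (fun t => x t b i : C^o).

(** The topology of [Sigma rad] is initial for evaluations at polynomials, so one polynomial at a
    time is enough. *)
Lemma two_point_law_continuous :
  continuous (fun t => two_point_law (xrad t) : Sigma rad).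
Proof.
have c P b : continuous (fun t => nceval (x t b) P : C^o).
  by apply: nceval_continuous => i; exact: xc.
apply: continuous_comp_initial => t; apply/cvg_sup => P.
have cP : continuous (fun t => two_point (x t) :
    initial_topology (fun l : ncpoly R I -> C^o => l P)).
  apply: continuous_comp_initial => s.
  by apply: cvgM; [apply: cvgD; exact: c|exact: cvg_cst].
exact: cP.
Qed.

Lemma AR_val_continuous b (g : AR rad) :
  continuous (fun t => AR_val (two_point_law (xrad t)) (x t b) g : C^o).
Proof.
apply: continuous_sum => w t; apply: cvgM; last by apply: word_val_continuous => i; exact: xc.
apply: (continuous_comp (f := fun t => two_point_law (xrad t) : Sigma rad)).
  exact: two_point_law_continuous.
exact: (@cts_fun _ _ (mcoeff w g)).
Qed.

End TwoPointContinuity.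

(** * Values of elements of the completion at a two-point law *)

Lemma cvg_dist_le {R : realType} (u : nat -> R) (a b d : R) : u n @[n --> \oo] --> a ->
  (exists n0, forall n, (n0 <= n)%N -> `|u n - b| <= d) -> `|a - b| <= d.
Proof.
move=> ua [n0 hn]; have c : `|u n - b| @[n --> \oo] --> `|a - b|.
  by apply: cvg_norm; apply: cvgB => //; exact: cvg_cst.
by apply: (cvgr_to_le c); exists n0.
Qed.

Lemma FR2_valueI {R : realType} {I : choiceType} (rad : I -> R) (H : hilbert R)
    (M : set (H -> H)) (tau : (H -> H) -> R[i]) (x : I -> H -> H) (F : FR2 rad) y :
  von_neumann M -> tracial_state M tau -> (forall i, M (x i)) -> M y ->
  (forall d, 0 < d -> exists n0, forall n, (n0 <= n)%N ->
    norm2 tau (AR_op tau x (reprc (val F) n) - y) < d) ->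
  FR2_value M tau x F y.
Proof.
move=> vM tM Mx My wy; split=> //.
pose w n := AR_op tau x (reprc (val F) n).
have Mw n : M (w n) := AR_op_in tau (reprc (val F) n) vM Mx.
apply/seteqP; split=> v [[Mv cv] hv]; split=> // d d0.
  have d2 : 0 < d / 2 by rewrite divr_gt0.
  have [n1 h1] := hv _ d2; have [n2 h2] := wy _ d2; exists (maxn n1 n2) => n.
  rewrite geq_max => /andP[/h1 p1 /h2 p2]; move: p1; rewrite !lte_fin => p1.
  apply: le_lt_trans (norm2_tri vM tM (U := w n) _ _ _) _ => //.
  by rewrite (norm2B vM tM) // [d]splitr ltrD.
have d2 : 0 < d / 2 by rewrite divr_gt0.
have [n1 h1] := hv _ d2; have [n2 h2] := wy _ d2; exists (maxn n1 n2) => n.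
rewrite geq_max => /andP[/h1 p1 /h2 p2]; move: p1; rewrite !lte_fin => p1.
apply: le_lt_trans (norm2_tri vM tM (U := y) (Mw n) _ _) _ => //.
by rewrite [d]splitr ltrD.
Qed.

Section TwoPointValue.
Context {R : realType} {I : choiceType} (rad : I -> R).
Local Notation C := R[i].
Hypothesis rad_ge0 : forall i, 0 <= rad i.

Lemma Re_le_nsq (z : C) d : 0 <= d -> nsq z <= d ^+ 2 -> `|complex.Re z| <= d.
Proof.
move=> d0; rewrite nsqE => h; rewrite -ler_sqr ?nnegrE // real_normK ?num_real //.
by apply: le_trans h; rewrite lerDl sqr_ge0.
Qed.

Lemma Im_le_nsq (z : C) d : 0 <= d -> nsq z <= d ^+ 2 -> `|complex.Im z| <= d.
Proof.
move=> d0; rewrite nsqE => h; rewrite -ler_sqr ?nnegrE // real_normK ?num_real //.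
by apply: le_trans h; rewrite lerDr sqr_ge0.
Qed.

(** Independent of the type [L2law l], so that values at different laws can be compared. *)
Definition FR_val (l : Sigma rad) (y : I -> C) (F : FR2 rad) : C :=
  Complex (limn (fun n => complex.Re (AR_val l y (reprc (val F) n))))
          (limn (fun n => complex.Im (AR_val l y (reprc (val F) n)))).

Variable x : bool -> I -> C.
Hypothesis xrad : forall b i, nsq (x b i) <= rad i ^+ 2.
Variable k : I.
Hypothesis xk : x true k != x false k.
Local Notation l := (two_point_law xrad).
Local Notation e := (L2basis xrad k).

(** The constant 2 is the square root of 2 from [AR_val_le], rounded up. *)
Lemma AR_val_close b (g h : AR rad) d : (normR2 (g - h)%R < d%:E)%E ->
  `|complex.Re (AR_val l (x b) g) - complex.Re (AR_val l (x b) h)| <= 2 * d /\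
  `|complex.Im (AR_val l (x b) g) - complex.Im (AR_val l (x b) h)| <= 2 * d.
Proof.
move=> gh; have := AR_val_le rad_ge0 xrad xk b gh; rewrite AR_valB.
have d0 : 0 <= d.
  have := normR2_ub (M := two_point_vna xrad xk) (g - h) (gns_var_ball rad_ge0 xrad xk).
  by move=> /le_lt_trans/(_ gh); rewrite lte_fin => /ltW; apply: le_trans; exact: sqrtr_ge0.
have d2 : 0 <= 2 * d by rewrite mulr_ge0.
move=> hn; have hn2 : nsq (AR_val l (x b) g - AR_val l (x b) h) <= (2 * d) ^+ 2.
  by apply: le_trans hn _; rewrite exprMn; have := sqr_ge0 d; lra.
rewrite -!ReN -!ReD -!ImN -!ImD.
by split; [exact: Re_le_nsq hn2|exact: Im_le_nsq hn2].
Qed.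

Lemma FR_val_cvg b (F : FR2 rad) :
  complex.Re (AR_val l (x b) (reprc (val F) n)) @[n --> \oo] -->
    complex.Re (FR_val l (x b) F) /\
  complex.Im (AR_val l (x b) (reprc (val F) n)) @[n --> \oo] -->
    complex.Im (FR_val l (x b) F).
Proof.
have hc d : 0 < d -> exists n0, forall n, (n0 <= n)%N ->
    (normR2 (reprc (val F) n0 - reprc (val F) n)%R < (d / 4)%:E)%E.
  move=> d0; have d4 : 0 < d / 4 by rewrite divr_gt0.
  by have [n0 h] := (reprc_cauchy F).2 _ d4; exists n0 => n; exact: h.
split; apply: (@R_complete R); apply: (@cauchy_exP R R) => d /[dup] d0 /hc[n0 hn].
  exists (complex.Re (AR_val l (x b) (reprc (val F) n0))); exists n0 => // n /= /hn.
  by move=> /(AR_val_close b) [h _]; rewrite /ball /=; lra.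
exists (complex.Im (AR_val l (x b) (reprc (val F) n0))); exists n0 => // n /= /hn.
by move=> /(AR_val_close b) [_ h]; rewrite /ball /=; lra.
Qed.

Lemma FR_val_close b (F : FR2 rad) g d :
  (exists n0, forall n, (n0 <= n)%N -> (normR2 (reprc (val F) n - g)%R < d%:E)%E) ->
  `|complex.Re (FR_val l (x b) F) - complex.Re (AR_val l (x b) g)| <= 2 * d /\
  `|complex.Im (FR_val l (x b) F) - complex.Im (AR_val l (x b) g)| <= 2 * d.
Proof.
move=> [n0 hn]; have [cR cI] := FR_val_cvg b F.
split; [apply: cvg_dist_le cR _|apply: cvg_dist_le cI _]; exists n0 => n /hn;
  by case/(AR_val_close b).
Qed.

Lemma FR2_value_two_point (F : FR2 rad) :
  FR2_value (law_vna l) (law_trace l) (gns_var l) F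
    (diag_op e (fun b => FR_val l (x b) F)).
Proof.
have he := L2basis_half xrad xk.
set y := diag_op e _; have vM := two_point_vn xrad xk; have tM := two_point_tracial xrad xk.
have My : law_vna l y by rewrite (law_vna_diag xrad xk); eexists.
set u := reprc (val F); pose w n := AR_op (law_trace l) (gns_var l) (u n).
have Mx i : law_vna l (gns_var l i) := proj1 (gns_var_ball rad_ge0 xrad xk i).
have wy d : 0 < d -> exists n0, forall n, (n0 <= n)%N -> norm2 (law_trace l) (w n - y) < d.
  move=> d0; have d4 : 0 < d / 4 by rewrite divr_gt0.
  have [n0 hn] := (reprc_cauchy F).2 _ d4; exists n0 => n nn0.
  (* Real and imaginary parts are within 2 (d / 4) = d / 2, so the squared 2-norm, an average of two
     such [nsq], is at most d^2 / 2. *)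
  have cl b : nsq (AR_val l (x b) (u n) - FR_val l (x b) F) <= 2 * (d / 2) ^+ 2.
    have [|hR hI] := @FR_val_close b F (u n) (d / 4).
      by exists n0 => m mn0; exact: hn.
    rewrite nsqE ReD ImD ReN ImN.
    by move: hR hI; rewrite !ler_norml => /andP[a1 a2] /andP[a3 a4]; nra.
  have -> : w n - y = diag_op e (fun b => AR_val l (x b) (u n) - FR_val l (x b) F).
    by rewrite /w (AR_op_diag xrad xk) (diag_sub he).
  rewrite (law_trace_diag xrad xk) (norm2_diag he).
  rewrite -[X in _ < X](ger0_norm (ltW d0)) -sqrtr_sqr ltr_sqrt ?exprn_gt0 //.
  by have := cl true; have := cl false; nra.
exact: (FR2_valueI vM tM Mx My wy).
Qed.

End TwoPointValue.

(** The usual argument for uniform limits, in local form: the approximant may depend on both [t] and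
    [e]. *)
Lemma continuous_approx {R : realType} (T : topologicalType) (a : T -> R) :
  (forall (t : T) e, 0 < e -> exists2 g : T -> R, continuous g &
    \forall s \near t, `|a s - g s| <= e) -> continuous a.
Proof.
move=> h t; apply/cvgrPdist_lt => e e0.
have e4 : 0 < e / 4 by rewrite divr_gt0.
have [g gc ag] := h t _ e4; have at_t := nbhs_singleton ag.
have : \forall s \near t, `|g t - g s| < e / 4 by exact: cvgr_dist_lt (gc t) _ e4.
apply: filterS2 ag => s; move: at_t; rewrite !ler_norml !ltr_norml.
move=> /andP[a1 a2] /andP[a3 a4] /andP[a5 a6]; apply/andP; split; lra.
Qed.

Lemma near_continuous {T U : topologicalType} (g : T -> U) (P : set U) (t : T) :
  continuous g -> (\forall u \near g t, P u) -> \forall s \near t, P (g s).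
Proof. by move=> gc; exact: gc. Qed.

(** * The antipodal family of laws and the collision of entries *)

Section AntipodalLaws.
Context {R : realType} {I : choiceType} (rad : I -> R) (i j : I).
Local Notation C := R[i].
Hypotheses (rad_ge0 : forall k, 0 <= rad k) (ij : i != j).
Hypotheses (rad_i : 0 < rad i) (rad_j : 0 < rad j).

(* Polar coordinates on a hemisphere of the sphere in C x R: the boundary circle
   is at s = 1, where t and t + 1 give antipodal points. *)
Definition hemisphere (p : R * R) (k : I) : C :=
  if k == i then Complex (rad i * sin (pi / 2 * p.1) * cos (pi * p.2))
                         (rad i * sin (pi / 2 * p.1) * sin (pi * p.2))
  else if k == j then Complex (rad j * cos (pi / 2 * p.1)) 0
  else 0.

Definition antipodes (p : R * R) (b : bool) (k : I) : C :=
  if b then hemisphere p k else - hemisphere p k.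

Lemma antipodes_rad p b k : nsq (antipodes p b k) <= rad k ^+ 2.
Proof.
have -> : nsq (antipodes p b k) = nsq (hemisphere p k) by case: b => //=; rewrite nsqN.
rewrite /hemisphere; case: eqP => [->|_].
  rewrite nsqE /= !exprMn -mulrDr cos2Dsin2 mulr1 ler_piMr ?sqr_ge0 //.
case: eqP => [->|_]; last by rewrite nsqE /= expr0n addr0 sqr_ge0.
rewrite nsqE /= expr0n addr0 exprMn ler_piMr ?sqr_ge0 //.
Qed.

(** Sine and cosine have no common zero. The separating coordinate depends on [p]: [i] fails at the
    pole and [j] on the boundary circle. *)
Lemma antipodes_neq p : exists k, antipodes p true k != antipodes p false k.
Proof.
have nz k : nsq (hemisphere p k) != 0 -> antipodes p true k != antipodes p false k.
  apply: contra => /eqP /= e; have : hemisphere p k *+ 2 = 0 by rewrite mulr2n {1}e addNr.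
  by move=> /eqP; rewrite mulrn_eq0 /= => /eqP ->; rewrite nsqE /= expr0n addr0.
have [s0|s0] := eqVneq (sin (pi / 2 * p.1)) 0.
  exists j; apply: nz; rewrite /hemisphere [j == i]eq_sym (negbTE ij) eqxx nsqE /= expr0n addr0.
  rewrite sqrf_eq0 mulf_neq0 ?(gt_eqF rad_j) //; apply/eqP => c0.
  by have := cos2Dsin2 (pi / 2 * p.1); rewrite s0 c0 expr0n addr0 => /eqP; rewrite eq_sym oner_eq0.
exists i; apply: nz; rewrite /hemisphere eqxx nsqE /= !exprMn -mulrDr cos2Dsin2 mulr1.
by rewrite mulf_neq0 // sqrf_eq0 // (gt_eqF rad_i).
Qed.

Lemma antipodes_continuous b k : continuous (fun p => antipodes p b k : C^o).
Proof.
have c1 (a : R) : continuous (fun p : R * R => a * p.1).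
  by move=> p; apply: cvgM; [exact: cvg_cst|exact: cvg_fst].
have c2 (a : R) : continuous (fun p : R * R => a * p.2).
  by move=> p; apply: cvgM; [exact: cvg_cst|exact: cvg_snd].
have hc : continuous (fun p => hemisphere p k : C^o).
  rewrite /hemisphere; case: eqP => _; last case: eqP => _; last exact: cst_continuous.
    apply: continuous_Complex => p; (apply: cvgM; first apply: cvgM); do ?[exact: cvg_cst];
      apply: continuous_comp; do ?[exact: c1|exact: c2|exact: continuous_sin|exact: continuous_cos].
  apply: continuous_Complex => p; last exact: cvg_cst.
  apply: cvgM; first exact: cvg_cst.
  by apply: continuous_comp; [exact: c1|exact: continuous_cos].
by case: b => [|p]; [exact: hc|exact: (cvgN (hc p))].
Qed.

Definition antipodal_law p : Sigma rad := two_point_law (antipodes_rad p).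

Lemma antipodal_law_eq p q : antipodes p = antipodes q -> antipodal_law p = antipodal_law q.
Proof. by move=> e; apply: val_inj; rewrite /= e. Qed.

Lemma antipodal_law_opp p q : (forall b, antipodes p b = antipodes q (~~ b)) ->
  antipodal_law p = antipodal_law q.
Proof.
move=> e; apply: val_inj => /=; apply/funext => P.
by rewrite /two_point !e /= addrC.
Qed.

Variable f : Sigma rad -> FR rad.
Hypothesis f_continuous : forall (l : Sigma rad) (e : R), 0 < e ->
  \forall l' \near l, (FR2_dist (val (f l')) (val (f l)) < e%:E)%E.

Definition antipodal_val p b : C :=
  FR_val (antipodal_law p) (antipodes p b) (val (f (antipodal_law p))).

Lemma antipodal_val_approx (p : R * R) (e : R) : 0 < e -> exists g : AR rad, \forall q \near p, forall b,
  `|complex.Re (antipodal_val q b) - complex.Re (AR_val (antipodal_law q) (antipodes q b) g)| <= e /\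
  `|complex.Im (antipodal_val q b) - complex.Im (AR_val (antipodal_law q) (antipodes q b) g)| <= e.
Proof.
move=> e0; have d0 : 0 < e / 4 by rewrite divr_gt0.
pose u := reprc (val (val (f (antipodal_law p)))).
have [n0 h0] : exists n0, forall n m, (n0 <= n)%N -> (n0 <= m)%N ->
    (normR2 (u n - u m)%R < (e / 4)%:E)%E by exact: (reprc_cauchy _).2.
exists (u n0).
have lc : continuous (antipodal_law : R * R -> Sigma rad).
  by apply: two_point_law_continuous; exact: antipodes_continuous.
have near_p := near_continuous lc (f_continuous (antipodal_law p) d0).
apply: filterS near_p => q /= /cdist_lt[n1 h1] b; have [k xk] := antipodes_neq q.
(* One e / 4 is for moving from [q] to [p], the other for replacing the sequence at [p] by its term
   [u n0]; the factor 2 is that of [FR_val_close]. *)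
have -> : e = 2 * (e / 4 + e / 4) by field.
apply: (FR_val_close rad_ge0 (antipodes_rad q) xk).
exists (maxn n0 n1) => n; rewrite geq_max => /andP[p0 p1].
apply: le_lt_trans (normR2_tri (u n) _ _) _.
by rewrite EFinD; apply: lteD; [exact: h1|exact: h0].
Qed.

Lemma Re_antipodal_val_continuous b : continuous (fun p => complex.Re (antipodal_val p b)).
Proof.
apply: continuous_approx => p e /(antipodal_val_approx p)[g hg].
exists (fun q => complex.Re (AR_val (antipodal_law q) (antipodes q b) g)).
  move=> q; apply: (continuous_comp (f := fun q => AR_val (antipodal_law q) (antipodes q b) g : C^o)).
    by apply: AR_val_continuous; exact: antipodes_continuous.
  exact: Re_continuous.
by apply: filterS hg => q /(_ b)[].
Qed.

Lemma Im_antipodal_val_continuous b : continuous (fun p => complex.Im (antipodal_val p b)).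
Proof.
apply: continuous_approx => p e /(antipodal_val_approx p)[g hg].
exists (fun q => complex.Im (AR_val (antipodal_law q) (antipodes q b) g)).
  move=> q; apply: (continuous_comp (f := fun q => AR_val (antipodal_law q) (antipodes q b) g : C^o)).
    by apply: AR_val_continuous; exact: antipodes_continuous.
  exact: Im_continuous.
by apply: filterS hg => q /(_ b)[].
Qed.

Lemma antipodal_val_eq p q b : hemisphere p = hemisphere q ->
  antipodal_val p b = antipodal_val q b.
Proof.
move=> e; have e' : antipodes p = antipodes q.
  by apply/funext => c; apply/funext => k; rewrite /antipodes e.
by rewrite /antipodal_val (antipodal_law_eq e') e'.
Qed.

(** Antipodal parameters give the same law, hence the same element of F_R; only the labels of the
    two points are exchanged. *)
Lemma antipodal_val_opp p q b : (forall k, hemisphere p k = - hemisphere q k) ->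
  antipodal_val p b = antipodal_val q (~~ b).
Proof.
move=> e; have e' c : antipodes p c = antipodes q (~~ c).
  by apply/funext => k; case: c; rewrite /antipodes /= e ?opprK.
by rewrite /antipodal_val (antipodal_law_opp e') e'.
Qed.

Lemma hemisphere_pole t : hemisphere (0, t) = hemisphere (0, 0).
Proof. by apply/funext => k; rewrite /hemisphere /= mulr0 sin0 !mulr0 !mul0r. Qed.

Lemma hemisphere_period s : hemisphere (s, 2) = hemisphere (s, 0).
Proof.
apply/funext => k; rewrite /hemisphere /= mulr0 sin0 cos0.
by rewrite mulr_natr cos2pi sin2pi.
Qed.

Lemma hemisphere_boundary t k : hemisphere (1, 1 + t) k = - hemisphere (1, t) k.
Proof.
rewrite /hemisphere /= !mulr1 sin_pihalf cos_pihalf (_ : pi * (1 + t) = pi * t + pi); last by ring.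
rewrite cosDpi sinDpi.
case: eqP => _; last case: eqP => _; rewrite ?oppr0 //.
  by congr Complex; rewrite /= ?mulr1 mulrN.
by congr Complex; rewrite /= ?mulr0 oppr0.
Qed.

Lemma antipodal_val_collision : exists p, antipodal_val p true = antipodal_val p false.
Proof.
pose u p := complex.Re (antipodal_val p true) - complex.Re (antipodal_val p false).
pose v p := complex.Im (antipodal_val p true) - complex.Im (antipodal_val p false).
have uc : continuous u by move=> p; apply: cvgB; exact: Re_antipodal_val_continuous.
have vc : continuous v by move=> p; apply: cvgB; exact: Im_antipodal_val_continuous.
have [|||p []] := planar_borsuk_ulam uc vc.
- by move=> t; rewrite /u /v !(antipodal_val_eq _ (hemisphere_pole t)).
- by move=> s; rewrite /u /v !(antipodal_val_eq _ (hemisphere_period s)).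
(* Exchanging the labels turns the difference of the entries into its opposite: this is the oddness
   on the boundary. *)
- move=> t; rewrite /u /v !(antipodal_val_opp _ (hemisphere_boundary t)) /=.
  by congr pair; rewrite /= opprB.
rewrite /u /v => /eqP; rewrite subr_eq0 => /eqP eR /eqP; rewrite subr_eq0 => /eqP eI.
by exists p; apply/eqP; rewrite eq_complex eR eI !eqxx.
Qed.

End AntipodalLaws.

Theorem theorem7p5 (R : realType) (I : countType) (rad : I -> R)
  (rad_ge0 : forall i, 0 <= rad i)
  (rad_nondeg : exists i j : I, [/\ i != j, 0 < rad i & 0 < rad j])
  (f : Sigma rad -> FR rad)
  (f_bounded : (ereal_sup [set normR (val (f l)) | l in [set: Sigma rad]] < +oo)%E)
  (f_continuous : forall (l : Sigma rad) (e : R), 0 < e ->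
     \forall l' \near l, (FR2_dist (val (f l')) (val (f l)) < e%:E)%E) :
  exists (l : Sigma rad) (y : L2law l -> L2law l),
    FR2_value (law_vna l) (law_trace l) (gns_var l)
      (val (f l)) y /\
    vn_generated y <> law_vna l.
Proof.
have [i [j [ij ri rj]]] := rad_nondeg.
have [p hp] := antipodal_val_collision rad_ge0 ij ri rj f_continuous.
pose xr := antipodes_rad rad i j p; have [k xk] := antipodes_neq ij ri rj p.
exists (antipodal_law rad i j p).
exists (diag_op (L2basis xr k) (antipodal_val i j f p)).
split; first exact: (FR2_value_two_point rad_ge0 xr xk).
rewrite (law_vna_diag xr xk); exact: (vn_generated_scalar (L2basis_half xr xk) hp).
Qed.
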